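(* Let $M$ be a fundamental shadow link complement and let $\mathcal T$ be the ideal triangulation of $M$ described in the context, in which each $D$-block is divided into 8 ideal tetrahedra. Then $\mathcal T$ satisfies the following properties. (1) The triangulation is geometric at the complete structure (i.e. the shape parameters have positive imaginary parts), and each $D$-block is a union of 2 regular ideal octahedra which are triangulated into 8 ideal tetrahedra with dihedral angles $(\pi/4,\pi/4,\pi/2)$. (2) Near the complete structure, the 8 shape parameters on each $D$-block are uniquely determined by two edge equations and six holonomy equations, and the solution can be explicitly written down in terms of the holonomies around the six ideal vertices. (3) The solution of the gluing equation of the triangulation $\mathcal T$ of the fundamental shadow link complement is given by a combination of the solutions on each $D$-block.
   Context: Fundamental shadow link complements. A truncated tetrahedron has four triangular faces (of truncation) and four hexagonal faces; its six edges are the intersections of pairs of hexagonal faces. A $D$-block is obtained by gluing two copies of a truncated tetrahedron along the hexagonal faces by the identity map and then removing the six edges; the doubles of the triangular faces are four 3-punctured spheres in its boundary. Gluing $c\ge 1$ copies of $D$-blocks along these 3-punctured spheres by orientation-reversing homeomorphisms gives a fundamental shadow link complement $M=\#^{c+1}(\mathbb S^2\times\mathbb S^1)\setminus L$, where the link $L$ is formed by the removed edges. $M$ is hyperbolic; ''the complete structure'' is its complete hyperbolic structure. The triangulation $\mathcal T$. Shrinking the six removed edges of a $D$-block to six ideal vertices turns each of its two truncated tetrahedra into an ideal octahedron; opposite edges of the tetrahedron become opposite vertices of the octahedron. The two octahedra are glued to each other along the four faces coming from the hexagonal faces, and the remaining faces (coming from the triangular faces) are the ones along which $D$-blocks are glued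 to each other. Each of the two octahedra is cut into four ideal tetrahedra around a central edge joining one pair of opposite ideal vertices (the same pair in both octahedra), so each $D$-block is divided into 8 ideal tetrahedra. Gluing the $D$-blocks as in the construction of $M$ gives the ideal triangulation $\mathcal T$ of $M$ with $8c$ ideal tetrahedra. Equations. Each ideal tetrahedron carries a shape parameter $z\in\mathbb C\setminus\{0,1\}$ on one pair of opposite edges (in $\mathcal T$, the pair containing the central edge), with $z'=\frac1{1-z}$ and $z''=1-\frac1z$ on the other two pairs. The logarithmic holonomy of a peripheral curve is the sum of the logarithms of the parameters at the corners it cuts off on its left minus the sum of those on its right. On a $D$-block, the two edge equations say that, around each of the two central edges, the sum of the logarithms of the four shape parameters is $2\pi\sqrt{-1}$; the six holonomy equations say that, for $l=1,\dots,6$, the logarithmic holonomy of the meridian $m_l$ of the cylinder at the $l$-th ideal vertex (the loop around the $l$-th removed edge) equals a given complex number $\mathrm H(m_l)$. The gluing equation of $\mathcal T$ consists of the edge equations of $\mathcal T$ (the sum of the logarithms of the parameters around an edge is $2\pi\sqrt{-1}$) together with the equations prescribing the logarithmic holonomies of the meridians of the components of $L$; each $D$-block inherits holonomies at its six ideal vertices from those of the link components. The complete structure corresponds to all these logarithmic holonomies being $0$. *)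

(* Defs.v *)
From HB Require Import structures.
From mathcomp Require Import all_boot all_order all_algebra all_fingroup.
From mathcomp Require Import complex.
From mathcomp Require Import all_classical all_reals all_analysis.

Set Implicit Arguments.
Unset Strict Implicit.
Unset Printing Implicit Defensive.

Import Order.TTheory GRing.Theory Num.Theory.
Import ComplexField.Normc.

Local Open Scope ring_scope.

(** * Complex logarithm and exponential *)

Section Complex.
Variable R : realType.
Implicit Types z : R[i].

(* The argument in ]-pi, pi]. *)
Definition carg z : R :=
  let a := acos (complex.Re z / normc z) in
  if 0 <= complex.Im z then a else - a.

Definition clog z : R[i] := Complex (ln (normc z)) (carg z).

Definition cexp z : R[i] :=
  (expR (complex.Re z))%:C%C
    * Complex (cos (complex.Im z)) (sin (complex.Im z)).

Definition two_pi_i : R[i] := Complex 0 (pi *+ 2).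

End Complex.

(** * Oriented ideal triangulations *)

(* The vertices of every tetrahedron are labelled by 'I_4, and face x is the
   one opposite to vertex x.  Face x of t is glued to a face of [adj t x] by
   the restriction of [glue t x] to the labels y != x, and [glue t x x] is
   the label of that face in [adj t x].  [orient t] holds when the labelling
   0, 1, 2, 3 of t is positively oriented, i.e. like (oo, 0, 1, z) with
   0 < Im z; gluings must reverse the orientations of the faces. *)
Record ideal_triangulation := IdealTriangulation {
  tetra : finType;
  orient : tetra -> bool;
  adj : tetra -> 'I_4 -> tetra;
  glue : tetra -> 'I_4 -> {perm 'I_4};
  adjK : forall t x, adj (adj t x) (glue t x x) = t;
  glueK : forall t x, glue (adj t x) (glue t x x) = (glue t x)^-1%g;
  adj_neq : forall t x, (adj t x, glue t x x) != (t, x);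
  glue_orient : forall t x,
    odd_perm (glue t x) = (orient t == orient (adj t x)) }.

(* An edge of a tetrahedron is a pair of vertices; the edges of the
   triangulation are the classes of edges of tetrahedra under face gluings. *)
Definition edge_rel (T : ideal_triangulation) : rel (tetra T * {set 'I_4}) :=
  [rel d d' : tetra T * {set 'I_4} |
     [exists x, (x \notin d.2)
                && (d' == (adj d.1 x, glue d.1 x @: d.2))]].

(* A step of a normal curve in the triangulated link of the ideal vertices: in
   the triangle at vertex [cusp] of a tetrahedron, it enters through the side
   in face [entry] and leaves through the side in face [exit], cutting off the
   corner at the edge from [cusp] to [pivot], the fourth label. *)
Record turn := Turn { cusp : 'I_4; entry : 'I_4; exit : 'I_4; pivot : 'I_4 }.

(* Parity of the permutation (0, 1, 2, 3) |-> (i, j, k, l). *)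
Definition odd4 (i j k l : 'I_4) : bool :=
  odd ((j < i) + (k < i) + (l < i) + (k < j) + (l < j) + (l < k))%N.

Definition turn_odd (s : turn) : bool :=
  odd4 (cusp s) (entry s) (exit s) (pivot s).

Section Shapes.
Variable R : realType.
Local Notation C := R[i].

Definition shape' (z : C) : C := (1 - z)^-1.
Definition shape'' (z : C) : C := 1 - z^-1.

(* z is on the edges 01 and 23.  Around a vertex, z, z', z'' occur in
   counterclockwise order, so that the orientation of the labelling decides
   which of z', z'' is on the edges 02 and 13. *)
Definition edge_param (o : bool) (z : C) (e : {set 'I_4}) : C :=
  if (e == [set 0; 1]) || (e == [set 2; 3]) then z
  else if ((e == [set 0; 2]) || (e == [set 1; 3])) == o then shape' z
  else shape'' z.

Definition edge_equations (T : ideal_triangulation) (z : tetra T -> C) : Prop :=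
  forall d : tetra T * {set 'I_4}, #|d.2| = 2%N ->
    \sum_(d' | connect (@edge_rel T) d d')
       clog (edge_param (orient d'.1) (z d'.1) d'.2) = two_pi_i R.

(* Seen from the ideal vertex, the corner cut off by a step is on its left iff
   (cusp, entry, exit, pivot) is a negatively oriented labelling. *)
Definition log_holonomy (T : Type) (o : T -> bool) (z : T -> C)
    (s : seq (T * turn)) : C :=
  \sum_(a <- s)
    let l := clog (edge_param (o a.1) (z a.1) [set cusp a.2; pivot a.2]) in
    if turn_odd a.2 == o a.1 then l else - l.

End Shapes.

(** * Fundamental shadow link complements *)

(* A gluing of c D-blocks.  In each block, the vertices of the truncated
   tetrahedron are labelled by 'I_4.  The i-th 3-punctured sphere (double of
   the i-th triangle of truncation) has one puncture for each edge {i, j},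
   j != i, and is glued to the sphere [sperm b i i] of the block [nbr b i],
   the puncture {i, j} going to {sperm b i i, sperm b i j}.  Up to isotopy,
   exactly one orientation-reversing homeomorphism of 3-punctured spheres
   induces a given bijection of the punctures and preserves the seams. *)
Record fsl_gluing (c : nat) := FslGluing {
  nbr : 'I_c -> 'I_4 -> 'I_c;
  sperm : 'I_c -> 'I_4 -> {perm 'I_4};
  nbrK : forall b i, nbr (nbr b i) (sperm b i i) = b;
  spermK : forall b i, sperm (nbr b i) (sperm b i i) = (sperm b i)^-1%g;
  nbr_neq : forall b i, (nbr b i, sperm b i i) != (b, i);
  nbr_connected : forall b b',
    connect [rel x y | [exists i, nbr x i == y]] b b' }.

(* The labels are chosen so that the central edges join the ideal vertices
   v_01 and v_23, where v_ij = v_ji is the ideal vertex which replaces the edge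
   {i, j}; [mate] exchanges 0 and 1, and 2 and 3. *)
Definition mate : {perm 'I_4} := (tperm 0%R 1%R * tperm 2%R 3%R)%g.

(* A D-block consists of the tetrahedra (s, i), where s is one of the two
   octahedra and i is the triangle of truncation which is a face of the
   tetrahedron.  The vertices of (s, i) are labelled as follows: j != i for
   v_ij, and i for the end of the central edge which is not v_(i, mate i).
   So the central edge joins the vertices i and mate i, and
   - face i is the i-th triangle of truncation;
   - face (mate i) comes from the hexagonal face (mate i), and is glued to the
     other octahedron by the identity map;
   - each other face x contains the central edge and is shared with the
     tetrahedron (s, mate x).
   The labelling is positive for s = true and negative for s = false. *)
Definition block_tetra : Type := (bool * 'I_4)%type.

Definition inner_glue (i x : 'I_4) : {perm 'I_4} :=
  (tperm i x * tperm (mate i) (mate x) * tperm i (mate i))%g.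

(* An odd permutation of the labels reverses the orientation of the triangles
   of truncation, hence maps front to front; an even one exchanges the two
   octahedra. *)
Definition fsl_adj c (G : fsl_gluing c) (t : 'I_c * block_tetra) (x : 'I_4) :
    'I_c * block_tetra :=
  let: (b, (s, i)) := t in
  if x == i then (nbr G b i, (s == odd_perm (sperm G b i), sperm G b i i))
  else if x == mate i then (b, (~~ s, i))
  else (b, (s, mate x)).

Definition fsl_glue c (G : fsl_gluing c) (t : 'I_c * block_tetra) (x : 'I_4) :
    {perm 'I_4} :=
  let: (b, (s, i)) := t in
  if x == i then sperm G b i
  else if x == mate i then 1%g
  else inner_glue i x.

Section FslTriangulation.
Variables (c : nat) (G : fsl_gluing c).

Let I4E (P : 'I_4 -> Prop) : P 0 -> P 1 -> P 2 -> P 3 -> forall i, P i.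
Proof.
move=> P0 P1 P2 P3 [[|[|[|[|//]]]] lti].
- by rewrite (_ : Ordinal lti = 0) //; apply: val_inj.
- by rewrite (_ : Ordinal lti = 1) //; apply: val_inj.
- by rewrite (_ : Ordinal lti = 2) //; apply: val_inj.
- by rewrite (_ : Ordinal lti = 3) //; apply: val_inj.
Qed.

Let mateE : (mate 0 = 1) * (mate 1 = 0) * (mate 2 = 3) * (mate 3 = 2).
Proof. by rewrite /mate !permM !permE. Qed.

Lemma mateK : involutive mate.
Proof. by elim/I4E; rewrite !mateE. Qed.

Lemma mate_neq i : (mate i == i) = false.
Proof. by elim/I4E: i; rewrite !mateE. Qed.

Lemma inner_glueE i x : x != i -> x != mate i ->
  [/\ inner_glue i x i = x, inner_glue i x x = mate i,
      inner_glue i x (mate i) = mate x & inner_glue i x (mate x) = i].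
Proof.
rewrite /inner_glue.
by elim/I4E: i; elim/I4E: x; rewrite !mateE // => _ _; rewrite !permM !permE.
Qed.

Lemma inner_glueV i x : x != i -> x != mate i ->
  inner_glue (mate x) (mate i) = (inner_glue i x)^-1%g.
Proof.
rewrite /inner_glue.
move=> ni nm; apply/permP=> y; apply: (can_inj (permK (inner_glue i x))).
rewrite permKV /inner_glue; move: ni nm.
by elim/I4E: i; elim/I4E: x; rewrite !mateE // => _ _;
  elim/I4E: y; rewrite !permM !permE.
Qed.

Lemma odd_inner_glue i x : x != i -> x != mate i -> odd_perm (inner_glue i x).
Proof.
rewrite /inner_glue.
by elim/I4E: i; elim/I4E: x; rewrite !mateE // => _ _; rewrite !odd_permM !odd_tperm.
Qed.

Lemma fsl_adjK t x : fsl_adj G (fsl_adj G t x) (fsl_glue G t x x) = t.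
Proof.
case: t => b [s i] /=; case: eqVneq => [->|ni].
  rewrite /= eqxx nbrK spermK permK odd_permV.
  by case: s; case: (odd_perm _).
case: eqVneq => [->|nm] /=; first by rewrite perm1 mate_neq eqxx negbK.
have [_ -> _ _] := inner_glueE ni nm.
by rewrite (inj_eq perm_inj) eq_sym (negPf ni) mateK eq_sym (negPf nm) mateK.
Qed.

Lemma fsl_glueK t x :
  fsl_glue G (fsl_adj G t x) (fsl_glue G t x x) = (fsl_glue G t x)^-1%g.
Proof.
case: t => b [s i] /=; case: eqVneq => [->|ni] /=; first by rewrite eqxx spermK.
case: eqVneq => [->|nm] /=; first by rewrite perm1 mate_neq eqxx invg1.
have [_ -> _ _] := inner_glueE ni nm.
rewrite (inj_eq perm_inj) eq_sym (negPf ni) mateK eq_sym (negPf nm).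
exact: inner_glueV.
Qed.

Lemma fsl_adj_neq t x : (fsl_adj G t x, fsl_glue G t x x) != (t, x).
Proof.
case: t => b [s i] /=; have [->|ni] := eqVneq x i.
  have := nbr_neq G b i; rewrite !xpair_eqE.
  by case: (nbr G b i == b); case: (_ == i); rewrite ?andbF.
have [->|nm] := eqVneq x (mate i); first by rewrite !xpair_eqE eqxx; case: s.
rewrite !xpair_eqE; apply/negP=> /andP[/andP[_ /andP[_ /eqP e]] _].
by rewrite -e mateK eqxx in nm.
Qed.

Lemma fsl_glue_orient t x :
  odd_perm (fsl_glue G t x) = (t.2.1 == (fsl_adj G t x).2.1).
Proof.
case: t => b [s i] /=; case: eqVneq => [_|ni] /=.
  by case: s; case: (odd_perm _).
case: eqVneq => [_|nm] /=; first by rewrite odd_perm1; case: s.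
by rewrite eqxx odd_inner_glue.
Qed.

Definition fsl_triangulation : ideal_triangulation :=
  IdealTriangulation fsl_adjK fsl_glueK fsl_adj_neq fsl_glue_orient.

End FslTriangulation.

(** * Meridians *)

(* The half, in the octahedron s = true, of the meridian of the edge {i, j}
   oriented from its i-th to its j-th end: it goes from the hexagonal face k to
   the hexagonal face l, where (i, j, k, l) is an even permutation.  This rule
   depends only on the orientations of the edge and of the manifold, so gluings
   match meridians of consecutive arcs of the link. *)
Definition half_meridian (i j : 'I_4) : seq ('I_4 * turn) :=
  let side (i j : 'I_4) := [:: (i, Turn j (mate i) (mate j) i);
                               (j, Turn i (mate i) (mate j) j)] in
  if j == mate i then
    let k := i + 2 in
    [:: (mate k, Turn (mate k) k (mate i) i);
        (i, Turn (mate i) k (mate k) i);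
        (k, Turn k (mate i) (mate k) i)]
  else if odd4 i j (mate i) (mate j) then side j i else side i j.

Definition reverse_turn (s : turn) : turn :=
  Turn (cusp s) (exit s) (entry s) (pivot s).

(* The closed normal curve around the removed edge {i, j} of a block; it comes
   back in the octahedron s = false along the mirror image. *)
Definition block_meridian (i j : 'I_4) : seq (block_tetra * turn) :=
  [seq ((true, a.1), a.2) | a <- half_meridian i j]
  ++ [seq ((false, a.1), reverse_turn a.2) | a <- rev (half_meridian i j)].

(* An arc (b, i, j), i != j, is the edge {i, j} of the block b, oriented from
   its i-th to its j-th end. *)
Definition link_arc (c : nat) : Type := ('I_c * 'I_4 * 'I_4)%type.

Definition proper_arc c (a : link_arc c) : bool := a.1.2 != a.2.

Definition rev_arc c (a : link_arc c) : link_arc c := (a.1.1, a.2, a.1.2).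

(* The next arc along the link: its orbits on proper arcs are the oriented
   components of the link. *)
Definition next_arc c (G : fsl_gluing c) (a : link_arc c) : link_arc c :=
  let: (b, i, j) := a in (nbr G b j, sperm G b j j, sperm G b j i).

Definition meridian c (a : link_arc c) :
    seq (('I_c * block_tetra) * turn) :=
  [seq ((a.1.1, d.1), d.2) | d <- block_meridian a.1.2 a.2].

(* A choice of meridians, at least one for each component of the link. *)
Definition meridian_system c (G : fsl_gluing c) (M : {set link_arc c}) : Prop :=
  (forall a, a \in M -> proper_arc a) /\
  (forall a, proper_arc a -> exists2 m, m \in M &
     fconnect (next_arc G) a m || fconnect (next_arc G) (rev_arc a) m).

(** * Gluing equations *)

Section Equations.
Variable R : realType.
Local Notation C := R[i].

(* A complex number for each oriented component of the link, which changes sign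
   with the orientation; it is inherited by the arcs of the component. *)
Definition link_holonomy c (G : fsl_gluing c) (H : link_arc c -> C) : Prop :=
  (forall a, H (rev_arc a) = - H a) /\
  (forall a, proper_arc a -> H (next_arc G a) = H a).

Definition gluing_equation c (G : fsl_gluing c) (M : {set link_arc c})
    (H : link_arc c -> C) (z : 'I_c * block_tetra -> C) : Prop :=
  edge_equations (T := fsl_triangulation G) z /\
  (forall m, m \in M ->
     log_holonomy (@orient (fsl_triangulation G)) z (meridian m) = H m).

Definition block_equations (h : 'I_4 -> 'I_4 -> C) (z : block_tetra -> C) :
    Prop :=
  (forall s : bool, \sum_(i < 4) clog (z (s, i)) = two_pi_i R) /\
  (forall i j : 'I_4, (i < j)%N ->
     log_holonomy fst z (block_meridian i j) = h i j).

Definition positive_shapes (T : Type) (z : T -> C) : Prop :=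
  forall t, 0 < complex.Im (z t).

Definition complete_structure c (G : fsl_gluing c) (M : {set link_arc c})
    (z : 'I_c * block_tetra -> C) : Prop :=
  positive_shapes z /\ gluing_equation G M (fun=> 0) z.

(* 'i is the shape parameter of the ideal tetrahedron with dihedral angles
   (pi / 2, pi / 4, pi / 4), hence that of every tetrahedron at the complete
   structure. *)
Definition near_complete (r : R) (T : Type) (z : T -> C) : Prop :=
  forall t, normc (z t - Complex 0 1) < r.

(* Write z_i, w_i for the shape parameters of (true, i), (false, i).  The
   products X_i = z_i' * w_i'' and Y_i = z_i'' * w_i' determine
     z_i = (X_i - 1) / (X_i * (1 - Y_i)), w_i = (Y_i - 1) / (Y_i * (1 - X_i)),
   and the holonomy equations with the product of the edge equations give
   X_i = x_i * t and Y_i = - (y_i * t)^-1 with a single unknown t.  Since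
   x_0 x_1 x_2 x_3 = y_0 y_1 y_2 y_3, the remaining equation
     \prod_i (1 - x_i * t) = \prod_i (1 + y_i * t)
   is quadratic in t; the root below is the one close to i. *)
Section Solution.
Variable h : 'I_4 -> 'I_4 -> C.

Let x (i : 'I_4) : C := cexp
  ([:: h 0 2; h 0 1 + h 2 3 + h 1 3; - h 0 2; h 0 1 + h 2 3 - h 1 3]`_i / 2).
Let y (i : 'I_4) : C := cexp
  ([:: h 0 1 - h 0 3; h 2 3 - h 1 2; h 2 3 + h 1 2; h 0 1 + h 0 3]`_i / 2).

Definition sym1 (u : 'I_4 -> C) : C := \sum_i u i.
Definition sym2 (u : 'I_4 -> C) : C :=
  \sum_(i < 4) \sum_(j < 4 | (i < j)%N) u i * u j.
Definition sym3 (u : 'I_4 -> C) : C := \sum_(i < 4) \prod_(j < 4 | j != i) u j.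

(* [sqrtC] is the square root with nonnegative imaginary part, and the
   discriminant is close to - 256. *)
Definition block_root : C :=
  let A := sym3 x + sym3 y in
  let B := sym2 x - sym2 y in
  let D := sym1 x + sym1 y in
  (B + sqrtC (B ^+ 2 - 4 * A * D)) / (2 * A).

Definition block_solution (a : block_tetra) : C :=
  let: (s, i) := a in
  let t := block_root in
  if s then y i * (x i * t - 1) / (x i * (1 + y i * t))
  else (1 + y i * t) / (1 - x i * t).

End Solution.

(** * Regular ideal octahedra *)

(* Ideal points of hyperbolic space, in homogeneous coordinates. *)
Definition ideal_point : Type := (C * C)%type.

Definition bracket (p q : ideal_point) : C := p.1 * q.2 - p.2 * q.1.

(* Normalized by (oo, 0, 1, z) |-> z. *)
Definition cross_ratio (p0 p1 p2 p3 : ideal_point) : C :=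
  (bracket p3 p1 * bracket p2 p0) / (bracket p3 p0 * bracket p2 p1).

(* The vertices oo, 0, 1, 'i, -1, - 'i of the regular ideal octahedron, labelled
   by the edges {i, j} of a tetrahedron, up to the reflection m. *)
Definition regular_vertex (m : bool) (i j : 'I_4) : ideal_point :=
  if j == mate i then if (i + j == 1)%N then (1, 0) else (0, 1)
  else ((if (i * j == 0)%N then 1 else -1)
          * (if (i + j == 3)%N then (-1) ^+ m * Complex 0 1 else 1), 1).

(* p is the image of the regular ideal octahedron by an isometry. *)
Definition regular_octahedron (p : 'I_4 -> 'I_4 -> ideal_point) : Prop :=
  exists (m : bool) (g : 'M[C]_2), g \in unitmx /\
    forall i j, i != j -> exists2 k : C, k != 0 &
      let v := regular_vertex m i j in
      p i j = (k * (g 0 0 * v.1 + g 0 1 * v.2),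
               k * (g 1 0 * v.1 + g 1 1 * v.2)).

(* The four tetrahedra (s, i) with shape parameters z i, placed side by side
   around their central edge, form the ideal octahedron with vertices p i j. *)
Definition octahedron_placement (s : bool) (z : 'I_4 -> C)
    (p : 'I_4 -> 'I_4 -> ideal_point) : Prop :=
  (forall i j, p i j = p j i) /\
  (forall i,
     let v j := if j == i then p (i + 2) (mate (i + 2)) else p i j in
     z i = if s then cross_ratio (v 0) (v 1) (v 2) (v 3)
           else cross_ratio (v 0) (v 1) (v 3) (v 2)).

End Equations.

(* Main.v *)
Require Import Defs.
From HB Require Import structures.
From mathcomp Require Import all_boot all_order all_algebra all_fingroup.
From mathcomp Require Import complex.
From mathcomp Require Import all_classical all_reals all_analysis.
From mathcomp Require Import ring lra.

(* For shapes with positive imaginary parts, log z + log z' + log z'' = pi i.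
   Write E(i, l) for the sum of the logarithms at the edge of a block in the i-th
   triangle of truncation and the l-th hexagonal face.  Under the central edge
   equations, the holonomy of the meridian of the edge {i, j} is
     2 pi i - sum_(l != i, j) E(i, l) = sum_(l != i, j) E(j, l) - 2 pi i.
   The remaining edges of the triangulation are obtained by gluing one edge (i, l)
   of a block to one edge (i', l') of a neighbour, and their equations are
   E(i, l) + E(i', l') = 2 pi i.  Hence these equations make the holonomy constant
   along each component of the link; conversely, if the holonomies agree at the
   three punctures of the i-th sphere, then the three defects of these equations
   have vanishing pairwise sums, so that they vanish.

   On one block, the logarithms of X_i = z_i' w_i'' and Y_i = z_i'' w_i' are given
   by the holonomies up to a common unknown log t, and the last equation is
   quadratic in t.  The root close to - i gives shapes close to - i, which are not
   positive.  The root close to i gives a solution of the exponentiated equations;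
   its arguments are close enough to those of the complete structure for the
   logarithmic equations to hold without multiples of 2 pi i. *)

Set Implicit Arguments.
Unset Strict Implicit.
Unset Printing Implicit Defensive.

Import Order.TTheory GRing.Theory Num.Theory.
Import ComplexField.Normc.

Local Open Scope ring_scope.

(** * Complex logarithm *)

Section ComplexLogarithm.
Variable R : realType.
Local Notation C := R[i].
Implicit Types u v z w : C.

Lemma complexP u v : complex.Re u = complex.Re v ->
  complex.Im u = complex.Im v -> u = v.
Proof. by case: u => a b; case: v => a' b' /= -> ->. Qed.

Lemma ReD u v : complex.Re (u + v) = complex.Re u + complex.Re v.
Proof. by case: u => ? ?; case: v. Qed.

Lemma ImD u v : complex.Im (u + v) = complex.Im u + complex.Im v.
Proof. by case: u => ? ?; case: v. Qed.

Lemma ReN u : complex.Re (- u) = - complex.Re u.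
Proof. by case: u. Qed.

Lemma ImN u : complex.Im (- u) = - complex.Im u.
Proof. by case: u. Qed.

Lemma ReM u v : complex.Re (u * v)
  = complex.Re u * complex.Re v - complex.Im u * complex.Im v.
Proof. by case: u => ? ?; case: v. Qed.

Lemma ImM u v : complex.Im (u * v)
  = complex.Re u * complex.Im v + complex.Im u * complex.Re v.
Proof. by case: u => ? ?; case: v => ? ? /=. Qed.

Definition sqnorm z : R := complex.Re z ^+ 2 + complex.Im z ^+ 2.

Lemma sqnorm_gt0 z : z != 0 -> 0 < sqnorm z.
Proof.
rewrite /sqnorm => z0; rewrite lt_def addr_ge0 ?sqr_ge0 // andbT.
apply: contra z0; rewrite paddr_eq0 ?sqr_ge0 // !sqrf_eq0.
by move=> /andP[/eqP re0 /eqP im0]; apply/eqP/complexP.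
Qed.

Lemma ReV z : complex.Re z^-1 = complex.Re z / sqnorm z.
Proof. by case: z. Qed.

Lemma ImV z : complex.Im z^-1 = - complex.Im z / sqnorm z.
Proof. by case: z => a b /=; rewrite mulNr. Qed.

Lemma normc_sqrt z : normc z = Num.sqrt (sqnorm z).
Proof. by case: z. Qed.

Lemma normc_gt0 z : z != 0 -> 0 < normc z.
Proof. by move=> z0; rewrite normc_sqrt sqrtr_gt0 sqnorm_gt0. Qed.

Lemma sqr_normc_sqnorm z : normc z ^+ 2 = sqnorm z.
Proof. by rewrite normc_sqrt sqr_sqrtr // addr_ge0 ?sqr_ge0. Qed.

Lemma le_Re_normc z : `|complex.Re z| <= normc z.
Proof.
rewrite normc_sqrt -sqrtr_sqr; apply: ler_wsqrtr.
by rewrite lerDl sqr_ge0.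
Qed.

Lemma le_Im_normc z : `|complex.Im z| <= normc z.
Proof.
rewrite normc_sqrt -sqrtr_sqr; apply: ler_wsqrtr.
by rewrite lerDr sqr_ge0.
Qed.

Lemma cexpD u v : cexp (u + v) = cexp u * cexp v.
Proof.
rewrite /cexp ReD ImD expRD cosD sinD.
by apply: complexP; rewrite !(ReM, ImM) /=; ring.
Qed.

Lemma cexp0 : cexp (0 : C) = 1.
Proof. by rewrite /cexp expR0 cos0 sin0 mul1r. Qed.

Lemma cexpN u : cexp (- u) = (cexp u)^-1.
Proof.
have e : cexp u * cexp (- u) = 1 by rewrite -cexpD subrr cexp0.
have n0 : cexp u != 0.
  by apply/eqP => e0; move: e; rewrite e0 mul0r => /eqP; rewrite eq_sym oner_eq0.
by apply: (mulfI n0); rewrite e mulfV.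
Qed.

Lemma cexp_neq0 u : cexp u != 0.
Proof.
apply/eqP => e0; have := cexpD u (- u); rewrite subrr cexp0 e0 mul0r => /eqP.
by rewrite oner_eq0.
Qed.

Lemma cexp_sum (I : Type) (r : seq I) (f : I -> C) :
  cexp (\sum_(i <- r) f i) = \prod_(i <- r) cexp (f i).
Proof. exact: (big_morph _ cexpD cexp0). Qed.

Lemma cexp_pi_i : cexp (Complex 0 pi) = -1 :> C.
Proof. by rewrite /cexp /= expR0 cospi sinpi mul1r; apply: complexP; rewrite /= ?oppr0. Qed.

Lemma cexp_2pi_i : cexp (two_pi_i R) = 1.
Proof.
by rewrite /cexp /= expR0 mul1r cos2pi sin2pi; apply: complexP.
Qed.

Lemma carg_itv z : - pi <= carg z <= pi.
Proof.
have pi0 := pi_gt0 R.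
rewrite /carg; set q := _ / _.
have q1 : -1 <= q <= 1.
  (* At z = 0 the quotient is 0 / 0 = 0 by convention, so the bound holds there too. *)
  have [z0|z0] := eqVneq z 0.
    by rewrite /q z0 /= mul0r lerN10 ler01.
  rewrite -ler_norml /q normrM normfV (ger0_norm (ltW (normc_gt0 z0))).
  by rewrite ler_pdivrMr ?normc_gt0 // mul1r le_Re_normc.
have := acos_ge0 q1; have := acos_lepi q1.
by case: ifP => _; lra.
Qed.

(** The arccosine of Re z / |z| has sine |Im z| / |z|; the sign chosen in [carg] turns this into Im
    z / |z|. *)
Lemma clogK z : z != 0 -> cexp (clog z) = z.
Proof.
move=> z0; have n0 := normc_gt0 z0; have nn : normc z != 0 by rewrite gt_eqF.
rewrite /cexp /clog /= lnK ?posrE // /carg; set q := _ / _.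
have q1 : -1 <= q <= 1.
  rewrite -ler_norml /q normrM normfV (ger0_norm (ltW n0)).
  by rewrite ler_pdivrMr // mul1r le_Re_normc.
have e : 1 - q ^+ 2 = (complex.Im z / normc z) ^+ 2.
  rewrite /q !exprMn !exprVn sqr_normc_sqnorm /sqnorm.
  have := sqnorm_gt0 z0; rewrite /sqnorm => /lt0r_neq0 h.
  by rewrite -{1}(divff h) -mulrBl addrAC subrr add0r.
have sE : sin (acos q) = `|complex.Im z| / normc z.
  by rewrite sin_acos // e sqrtr_sqr normrM normfV (ger0_norm (ltW n0)).
apply: complexP; rewrite !(ReM, ImM) /= mul0r ?subr0 ?addr0.
  by case: ifP => _; rewrite ?cosN acosK // /q mulrC divfK.
case: ifP => h; rewrite ?sinN sE mulrC.
  by rewrite divfK // ger0_norm.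
rewrite mulNr divfK // ler0_norm ?opprK //.
by rewrite leNgt; apply/negP => /ltW; rewrite h.
Qed.

Lemma cexp_eq1 u : cexp u = 1 -> `|complex.Im u| < pi *+ 2 -> u = 0.
Proof.
case: u => a b /=; rewrite /cexp /= => e lt2.
have eR : expR a * cos b = 1.
  by move: (congr1 (@complex.Re R) e); rewrite ReM /= mul0r subr0.
have eI : sin b = 0.
  move: (congr1 (@complex.Im R) e); rewrite ImM /= mul0r addr0 => /eqP.
  by rewrite mulf_eq0 gt_eqF ?expR_gt0 //= => /eqP.
have pi0 := pi_gt0 R.
have c0 : 0 < cos b.
  by rewrite -(pmulr_rgt0 _ (expR_gt0 a)) eR ltr01.
have c1 : cos b = 1.
  have := cos2Dsin2 b; rewrite eI expr0n addr0 => /eqP.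
  by rewrite sqrf_eq1 => /orP[/eqP //|/eqP h]; move: c0; rewrite h; lra.
have a0 : a = 0.
  by apply: (@expR_inj R); rewrite expR0 -eR c1 mulr1.
suff b0 : b = 0 by rewrite a0 b0.
(* cos b = 1 - 2 sin^2 (b / 2) *)
have s0 : sin (b / 2) = 0.
  have := cos_mulr2n (b / 2); rewrite cos2sin2 -[(b / 2) *+ 2]mulr_natr divfK // c1 => h.
  by apply/eqP; rewrite -sqrf_eq0; apply/eqP; move: h; rewrite -[_ *+ 2]mulr_natr; lra.
have lt1 : `|b / 2| < pi.
  by rewrite normrM (ger0_norm (_ : 0 <= 2^-1)) ?invr_ge0 // ltr_pdivrMr // mulr_natr.
move: lt1; rewrite ltr_norml => /andP[l1 l2].
have [bp|bn|//] := ltgtP 0 b.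
  have := @sin_gt0_pi R (b/2); rewrite s0 ltxx => /(_ _).
  by have : 0 < b/2 < pi; [lra | move=> -> /(_ isT)].
have := @sin_gt0_pi R (- (b/2)); rewrite sinN s0 oppr0 ltxx => /(_ _).
by have : 0 < -(b/2) < pi; [lra | move=> -> /(_ isT)].
Qed.

(** The bridge from multiplicative to logarithmic equations: bounds on arguments rule out any
    nonzero multiple of 2 pi i. *)
Lemma cexp_inj u v : cexp u = cexp v ->
  `|complex.Im u - complex.Im v| < pi *+ 2 -> u = v.
Proof.
move=> e lt2; apply/eqP; rewrite -subr_eq0; apply/eqP/cexp_eq1.
  by rewrite cexpD cexpN e mulfV ?cexp_neq0.
by rewrite ImD ImN.
Qed.

Lemma carg_gt0 z : 0 < complex.Im z -> 0 < carg z < pi.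
Proof.
move=> z0; have zn : z != 0 by apply: contraTneq z0 => ->; rewrite ltxx.
have := clogK zn; have := carg_itv z; rewrite {1}/carg (ltW z0).
have -> : acos (complex.Re z / normc z) = carg z by rewrite /carg (ltW z0).
move=> /andP[_ le1] e.
have : complex.Im z = normc z * sin (carg z).
  by rewrite -{1}e /cexp ImM /= mul0r addr0 lnK ?posrE ?normc_gt0.
have ge0 : 0 <= carg z.
  rewrite /carg (ltW z0); apply: acos_ge0.
  rewrite -ler_norml normrM normfV (ger0_norm (ltW (normc_gt0 zn))).
  by rewrite ler_pdivrMr ?normc_gt0 // mul1r le_Re_normc.
move=> e2; rewrite !lt_def ge0 le1 !andbT; apply/andP; split.
  by apply: contraTneq z0 => h; rewrite e2 h sin0 mulr0 ltxx.
by apply: contraTneq z0 => h; rewrite e2 -h sinpi mulr0 ltxx.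
Qed.

Lemma carg_lt_pihalf z : 0 < complex.Im z -> 0 < complex.Re z -> carg z < pi / 2.
Proof.
move=> im0 re0; have zn : z != 0 by apply: contraTneq re0 => ->; rewrite ltxx.
have /andP[a0 a1] := carg_gt0 im0; rewrite ltNge; apply/negP => ge.
have : complex.Re z = normc z * cos (carg z).
  by rewrite -{1}(clogK zn) /cexp ReM /= mul0r subr0 lnK ?posrE ?normc_gt0.
move=> e; move: re0; rewrite e pmulr_rgt0 ?normc_gt0 //.
have pi0 := pi_gt0 R; rewrite -cos_pihalf ltr_cos ?in_itv /=; lra.
Qed.

Lemma Im_shape' z : 0 < complex.Im z -> 0 < complex.Im (shape' z).
Proof.
move=> z0; rewrite /shape' ImV ImD ImN add0r opprK divr_gt0 // sqnorm_gt0 //.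
by rewrite subr_eq0; apply: contraTneq z0 => <-; rewrite ltxx.
Qed.

Lemma Im_shape'' z : 0 < complex.Im z -> 0 < complex.Im (shape'' z).
Proof.
move=> z0; rewrite /shape'' ImD ImN add0r ImV mulNr opprK divr_gt0 // sqnorm_gt0 //.
by apply: contraTneq z0 => ->; rewrite ltxx.
Qed.

Lemma Im_neq0 z : 0 < complex.Im z -> z != 0.
Proof. by apply: contraTneq => ->; rewrite ltxx. Qed.

Lemma Im_neq1 z : 0 < complex.Im z -> 1 - z != 0.
Proof. by rewrite subr_eq0; apply: contraTneq => <-; rewrite ltxx. Qed.

(** The product z z' z'' is -1, and the three arguments lie in ]0, pi[, so their sum is within 2 pi
    of pi. *)
Lemma clog_shapes z : 0 < complex.Im z ->
  clog z + clog (shape' z) + clog (shape'' z) = Complex 0 pi.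
Proof.
move=> z0; have z1 := Im_shape' z0; have z2 := Im_shape'' z0.
apply: cexp_inj.
  rewrite !cexpD !clogK ?Im_neq0 // cexp_pi_i /shape' /shape''.
  have := Im_neq0 z0; have := Im_neq1 z0.
  by move=> h h'; field; rewrite h'.
have := carg_gt0 z0; have := carg_gt0 z1; have := carg_gt0 z2.
have pi0 := pi_gt0 R.
rewrite !ImD /= => /andP[a1 a2] /andP[b1 b2] /andP[c1 c2].
by rewrite ltr_norml -[pi *+ 2]mulr_natr; apply/andP; split; lra.
Qed.

End ComplexLogarithm.

(** * Holonomies and edges of a block *)

Lemma I4E (P : 'I_4 -> Prop) : P 0 -> P 1 -> P 2 -> P 3 -> forall i, P i.
Proof.
move=> P0 P1 P2 P3 [[|[|[|[|//]]]] lti].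
- by rewrite (_ : Ordinal lti = 0) //; apply: val_inj.
- by rewrite (_ : Ordinal lti = 1) //; apply: val_inj.
- by rewrite (_ : Ordinal lti = 2) //; apply: val_inj.
- by rewrite (_ : Ordinal lti = 3) //; apply: val_inj.
Qed.

Lemma mateE : (mate 0%R = 1%R) * (mate 1%R = 0%R) * (mate 2%R = 3%R) * (mate 3%R = 2%R).
Proof. by rewrite /mate !permM !permE. Qed.

Lemma I4_add2 : ((0 + 2)%R = 2%R :> 'I_4) * ((1 + 2)%R = 3%R :> 'I_4)
  * ((2 + 2)%R = 0%R :> 'I_4) * ((3 + 2)%R = 1%R :> 'I_4).
Proof. by do !split; apply: val_inj. Qed.

Lemma eq_set2 (T : finType) (i j k l : T) :
  ([set i; j] == [set k; l])
    = (i == k) && (j == l) || (i == l) && (j == k).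
Proof.
apply/eqP/idP => [e|/orP[/andP[/eqP-> /eqP->]|/andP[/eqP-> /eqP->]] //].
  have h : [set i; j] =i [set k; l] by rewrite e.
  have := h i; have := h j; have := h k; have := h l.
  rewrite !inE !eqxx !orbT /= ?orbT (eq_sym k i) (eq_sym l i) (eq_sym k j) (eq_sym l j).
  have [eik|] := eqVneq i k; have [eil|] := eqVneq i l;
  have [ejk|] := eqVneq j k; have [ejl|] := eqVneq j l; rewrite ?orbT //=.
by rewrite finset.setUC.
Qed.

Lemma sumI4 (V : nmodType) (F : 'I_4 -> V) :
  \sum_i F i = F 0 + F 1 + F 2 + F 3.
Proof.
rewrite !big_ord_recl big_ord0 addr0 !addrA.
by congr (F _ + F _ + F _ + F _); apply: val_inj.
Qed.

Lemma prodI4 (V : comPzRingType) (F : 'I_4 -> V) :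
  \prod_i F i = F 0 * F 1 * F 2 * F 3.
Proof.
rewrite !big_ord_recl big_ord0 mulr1 !mulrA.
by congr (F _ * F _ * F _ * F _); apply: val_inj.
Qed.

Section EdgeParameter.
Variable R : realType.
Local Notation C := R[i].

(** The sum of its labels determines an edge up to passing to the opposite one: 1 and 5 for 01 and
    23, 2 and 4 for 02 and 13, 3 for both 03 and 12. *)
Lemma edge_paramE (o : bool) (z : C) (i j : 'I_4) : i != j ->
  edge_param o z [set i; j] =
  match (i + j)%N with
  | 1 | 5 => z
  | 3 => if o then shape'' z else shape' z
  | _ => if o then shape' z else shape'' z
  end.
Proof.
rewrite /edge_param !eq_set2.
by elim/I4E: i; elim/I4E: j => // _; case: o.
Qed.

Variable z : block_tetra -> C.

Definition corner (s : bool) (i j k : 'I_4) : C :=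
  clog (edge_param s (z (s, i)) [set j; k]).

(* At the edge of the block in the i-th triangle of truncation and the l-th
   hexagonal face. *)
Definition edge_angle (i l : 'I_4) : C := \sum_(s : bool)
  if l == mate i then corner s i (i + 2) (mate (i + 2))
  else corner s i (mate i) (mate l) + corner s (mate l) i (mate l).

Definition central_equations : Prop :=
  forall s : bool, \sum_(i < 4) clog (z (s, i)) = two_pi_i R.

Hypothesis z_gt0 : positive_shapes z.
Hypothesis z_central : central_equations.

(** The two formulas read the meridian at the two ends of the removed edge. Once log z'' is
    eliminated through [clog_shapes] and the fourth log z of each octahedron through its central
    equation, both are linear identities, checked for the twelve oriented edges. *)
Lemma block_holonomyE (i j : 'I_4) : i != j ->
  log_holonomy fst z (block_meridian i j)
    = two_pi_i R - \sum_(l | (l != i) && (l != j)) edge_angle i l /\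
  log_holonomy fst z (block_meridian i j)
    = \sum_(l | (l != i) && (l != j)) edge_angle j l - two_pi_i R.
Proof.
pose P : C := Complex 0 pi.
have PE : two_pi_i R = P + P by apply: complexP; rewrite /= ?addr0 // mulr2n.
have zE s k : clog (shape'' (z (s, k))) = P - clog (z (s, k)) - clog (shape' (z (s, k))).
  by rewrite /P -(clog_shapes (z_gt0 (s, k))); ring.
have cE s : clog (z (s, 3)) = P + P - clog (z (s, 0))
    - clog (z (s, 1)) - clog (z (s, 2)).
  by rewrite -PE -(z_central s) sumI4; ring.
rewrite PE (big_mkcond (fun l => _ && _)) /=.
rewrite [X in _ /\ _ = X - _](big_mkcond (fun l => _ && _)) /=.
rewrite /log_holonomy /block_meridian /half_meridian !sumI4 /edge_angle !big_bool /corner.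
elim/I4E: i; elim/I4E: j => // _;
  rewrite !mateE /= ?I4_add2 ?mateE !big_cons big_nil /= !edge_paramE //= ?zE ?cE;
  split; ring.
Qed.

End EdgeParameter.

(** * Edge classes *)

Section EdgeRelation.
Variable T : ideal_triangulation.

Lemma edge_rel_sym : symmetric (@edge_rel T).
Proof.
suff h d d' : @edge_rel T d d' -> @edge_rel T d' d.
  by move=> d d'; apply/idP/idP; apply: h.
case: d d' => [t e] [t' e'] /existsP[x /andP[/= xe /eqP[-> ->]]].
apply/existsP; exists (Defs.glue t x x) => /=.
rewrite mem_imset ?xe /=; last exact: perm_inj.
rewrite adjK glueK -imset_comp (eq_imset (g := id)) ?imset_id // => y /=.
by rewrite permK.
Qed.

Lemma edge_connect_sym : connect_sym (@edge_rel T).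
Proof. exact: sym_connect_sym edge_rel_sym. Qed.

Lemma edge_step (t : tetra T) (e : {set 'I_4}) x : x \notin e ->
  connect (@edge_rel T) (t, e) (adj t x, Defs.glue t x @: e).
Proof. by move=> xe; apply/connect1/existsP; exists x; rewrite /= xe eqxx. Qed.

Lemma edge_classP (s : seq (tetra T * {set 'I_4})) d0 :
  (forall d x, d \in s -> x \notin d.2 ->
     (adj d.1 x, Defs.glue d.1 x @: d.2) \in s) ->
  (forall d, d \in s -> connect (@edge_rel T) d d0) ->
  forall d, d \in s -> connect (@edge_rel T) d =1 mem s.
Proof.
move=> cl co d ds d'; apply/idP/idP => [dd'|d's]; last first.
  by apply: connect_trans (co _ ds) _; rewrite edge_connect_sym co.
have h : fingraph.closed (@edge_rel T) (mem s).
  apply: (intro_closed edge_connect_sym) => /= -[t e] v.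
  move=> /existsP[x /andP[/= xe /eqP ->]] ts.
  exact: (cl (t, e) x).
by have := closed_connect h dd'; rewrite -[mem s d']/(d' \in s) => <-.
Qed.

End EdgeRelation.

(* The pairs (k, e) such that, in both octahedra s, the edge e of the
   tetrahedron (s, k) is the edge of the block in the i-th triangle of truncation
   and the l-th hexagonal face. *)
Definition corners (i l : 'I_4) : seq ('I_4 * {set 'I_4}) :=
  if l == mate i then [:: (i, ~: [set i; l])]
  else [:: (i, ~: [set i; l]); (mate l, [set i; mate l])].

(** The triangle of truncation can be read off from a corner: it is the index of the tetrahedron if
    this index is not in the edge, and the other label of the edge if it is. *)
Lemma corners_inj i l i' l' a : i != l -> i' != l' ->
  a \in corners i l -> a \in corners i' l' -> i = i'.
Proof.
move=> il il'.
suff h k m : k != m -> a \in corners k m ->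
    if a.1 \in a.2 then a.2 = [set k; a.1] /\ k != a.1 else a.1 = k.
  move=> /(h _ _ il) + /(h _ _ il'); case: ifP => _; last by move=> <-.
  move=> [-> n] [+ n'] => /setP/(_ i); rewrite !inE eqxx /=.
  by rewrite (negPf n) orbF => /esym/eqP.
rewrite /corners => km; case: ifPn => [_|km']; rewrite !inE.
  by move=> /eqP-> /=; rewrite !inE eqxx.
case/orP=> /eqP-> /=; rewrite !inE eqxx // orbT; split=> //.
by apply: contra km' => /eqP->; rewrite mateK.
Qed.

(** * Edge classes of the triangulation of a fundamental shadow link complement *)

Section EdgeClasses.
Variables (c : nat) (G : fsl_gluing c).
Local Notation T := (fsl_triangulation G).
Local Notation dart := (('I_c * block_tetra) * {set 'I_4})%type.

Definition central_class (b : 'I_c) (s : bool) : seq dart :=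
  [seq ((b, (s, i)), [set i; mate i]) | i <- enum 'I_4].

Definition outer_half (b : 'I_c) (i l : 'I_4) : seq dart :=
  [seq ((b, (s, a.1)), a.2) | s <- [:: true; false], a <- corners i l].

Definition outer_class (b : 'I_c) (i l : 'I_4) : seq dart :=
  outer_half b i l ++ outer_half (nbr G b i) (sperm G b i i) (sperm G b i l).

Lemma mem_outer_half (d : dart) b i l :
  (d \in outer_half b i l)
    = (d.1.1 == b) && ((d.1.2.2, d.2) \in corners i l).
Proof.
case: d => -[b' [s i']] e /=; apply/allpairsP/andP => [[[s' a] /= [_ ac [-> _ -> ->]]]|].
  by rewrite eqxx; case: a ac.
by move=> [/eqP-> ac]; exists (s, (i', e)); split=> //=; case: s.
Qed.

Lemma mem_outer_class (d : dart) b i l :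
  (d \in outer_class b i l)
    = (d.1.1 == b) && ((d.1.2.2, d.2) \in corners i l)
   || (d.1.1 == nbr G b i)
      && ((d.1.2.2, d.2) \in corners (sperm G b i i) (sperm G b i l)).
Proof. by rewrite mem_cat !mem_outer_half. Qed.

Lemma imset_set2 (aT rT : finType) (f : aT -> rT) x y :
  f @: [set x; y] = [set f x; f y].
Proof. by rewrite imsetU !imset_set1. Qed.

Lemma inner_step b s i x (e : {set 'I_4}) : x != i -> x != mate i -> x \notin e ->
  connect (@edge_rel T) ((b, (s, i)), e) ((b, (s, mate x)), inner_glue i x @: e).
Proof.
move=> xi xm xe; have := @edge_step T (b, (s, i)) e x xe.
by rewrite /= (negPf xi) (negPf xm).
Qed.

Lemma flip_step b s i (e : {set 'I_4}) : mate i \notin e ->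
  connect (@edge_rel T) ((b, (s, i)), e) ((b, (~~ s, i)), e).
Proof.
move=> xe; have := @edge_step T (b, (s, i)) e (mate i) xe.
rewrite /= mate_neq eqxx (eq_imset (g := id)) ?imset_id // => y.
by rewrite perm1.
Qed.

Lemma outer_step b s i (e : {set 'I_4}) : i \notin e ->
  connect (@edge_rel T) ((b, (s, i)), e)
    ((nbr G b i, (s == odd_perm (sperm G b i), sperm G b i i)), sperm G b i @: e).
Proof.
move=> xe; have := @edge_step T (b, (s, i)) e i xe.
by rewrite /= eqxx.
Qed.

Lemma inner_glue_axis i x : x != i -> x != mate i ->
  inner_glue i x @: [set i; mate i] = [set mate x; x].
Proof.
move=> xi xm; have [e1 e2 e3 e4] := inner_glueE xi xm.
by rewrite imset_set2 e1 e3 finset.setUC.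
Qed.

Lemma mate_flip (i j : 'I_4) : (mate i == j) = (i == mate j).
Proof. by rewrite -[in RHS](inj_eq (@perm_inj _ mate)) mateK. Qed.

Lemma central_class_connect b s d : d \in central_class b s ->
  connect (@edge_rel T) d =1 mem (central_class b s).
Proof.
move: d; apply: (@edge_classP T _ ((b, (s, 0)), [set 0; mate 0])).
  move=> d x /mapP[i _ ->] /=; rewrite !inE negb_or => /andP[xi xm].
  rewrite (negPf xi) (negPf xm) inner_glue_axis //; apply/mapP; exists (mate x).
    by rewrite mem_enum.
  by rewrite mateK.
move=> d /mapP[i _ ->].
have step k x : x != k -> x != mate k ->
    connect (@edge_rel T) ((b, (s, k)), [set k; mate k])
                          ((b, (s, mate x)), [set mate x; x]).
  move=> xk xm; have := @inner_step b s k x [set k; mate k] xk xm.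
  by rewrite inner_glue_axis // !inE negb_or xk xm; apply.
(* Around a central edge the tetrahedra 0 and 1 alternate with 2 and 3, so 1 reaches 0 through 2. *)
have st2 : connect (@edge_rel T) ((b, (s, 2)), [set 2; mate 2])
    ((b, (s, 0)), [set 0; mate 0]).
  by have := step 2 1; rewrite !mateE; apply.
elim/I4E: i => //.
  by apply: connect_trans st2; have := step 1 3; rewrite !mateE; apply.
by have := step 3 1; rewrite !mateE; apply.
Qed.

Lemma setC_label (i l : 'I_4) : i != l -> l != mate i ->
  ~: [set i; l] = [set mate i; mate l].
Proof.
move=> il lm; apply/setP => x; rewrite !inE.
by move: il lm; elim/I4E: i; elim/I4E: l; elim/I4E: x; rewrite !mateE.
Qed.

Lemma outer_half_connect b i l d : i != l -> d \in outer_half b i l ->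
  connect (@edge_rel T) d ((b, (true, i)), ~: [set i; l]).
Proof.
move=> il; have lm_neq : mate l != l by rewrite mate_neq.
have li : l != i by rewrite eq_sym.
have st s : connect (@edge_rel T) ((b, (s, i)), ~: [set i; l])
    ((b, (true, i)), ~: [set i; l]).
  case: s => //; have [lm|lm] := eqVneq l (mate i).
    by apply: flip_step; rewrite !inE lm eqxx orbT.
  rewrite setC_label //.
  have e : inner_glue i l @: [set mate i; mate l] = [set mate l; i].
    by have [_ _ e3 e4] := inner_glueE li lm; rewrite imset_set2 e3 e4.
  have inn s : connect (@edge_rel T) ((b, (s, i)), [set mate i; mate l])
      ((b, (s, mate l)), [set mate l; i]).
    have := @inner_step b s i l [set mate i; mate l]; rewrite e; apply=> //.
    by rewrite !inE negb_or lm eq_sym.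
  (* The hexagonal face of the tetrahedron i does not contain this edge, so the other octahedron is
     reached through the tetrahedron [mate l], whose hexagonal face l does. *)
  apply: connect_trans (inn _) _; rewrite edge_connect_sym.
  apply: connect_trans (inn _) _; apply: flip_step.
  by rewrite mateK !inE negb_or eq_sym lm_neq eq_sym.
case: d => -[b' [s i']] e; rewrite mem_outer_half /= => /andP[/eqP->].
rewrite /corners; case: ifPn => [_|lm]; rewrite !inE; first by case/eqP => -> ->.
case/orP => /eqP[-> ->] //.
apply: connect_trans (st s); rewrite setC_label // edge_connect_sym.
have e' : inner_glue i l @: [set mate i; mate l] = [set i; mate l].
  have [_ _ e3 e4] := inner_glueE li lm.
  by rewrite imset_set2 e3 e4 finset.setUC.
have := @inner_step b s i l [set mate i; mate l]; rewrite e'; apply=> //.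
by rewrite !inE negb_or lm eq_sym.
Qed.

(** Since the gluing of spheres is an involution, steps starting in the second half of a class
    reduce to steps starting in the first. *)
Lemma outer_class_swap b i l :
  outer_class (nbr G b i) (sperm G b i i) (sperm G b i l)
    =i outer_class b i l.
Proof.
move=> d; rewrite !mem_outer_class nbrK spermK !permK orbC.
by [].
Qed.

Lemma corner_image b i l : sperm G b i @: (~: [set i; l])
  = ~: [set sperm G b i i; sperm G b i l].
Proof.
apply/setP => x; rewrite -[x](permKV (sperm G b i)) mem_imset; last exact: perm_inj.
by rewrite !inE !(inj_eq perm_inj).
Qed.

Lemma mem_corners_head i l : (i, ~: [set i; l]) \in corners i l.
Proof. by rewrite /corners; case: ifP => _; rewrite !inE eqxx. Qed.

(** There are three kinds of faces to cross: a triangle of truncation leads to the other half of the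
    class, a hexagonal face to the same corner in the other octahedron, and a face through the
    central edge exchanges the two corners in one octahedron. *)
Lemma outer_class_step b i l d x : i != l -> d \in outer_half b i l ->
  x \notin d.2 ->
  (adj (i := T) d.1 x, Defs.glue (i := T) d.1 x @: d.2) \in outer_class b i l.
Proof.
move=> il; case: d => -[b' [s i']] e; rewrite mem_outer_half /= => /andP[/eqP->].
move=> cor xe; rewrite mem_outer_class.
have [xi|xi] := eqVneq x i'.
  rewrite xi /= in xe *; move: cor xe.
  rewrite /corners; case: ifPn => [_|lm]; rewrite !inE.
    by case/eqP => -> ->; rewrite corner_image mem_corners_head eqxx orbT.
  case/orP => /eqP[-> ->]; last by rewrite !inE eqxx orbT.
  by rewrite corner_image mem_corners_head eqxx orbT.
have [xm|xm] := eqVneq x (mate i').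
  rewrite /= eqxx (eq_imset (g := id)) ?imset_id ?cor // => y.
  by rewrite perm1.
rewrite /= eqxx; apply/orP; left; move: cor xe xi xm.
rewrite /corners; case: ifPn => [/eqP lm|lm]; rewrite !inE.
  case/eqP => -> ->; rewrite !inE negbK => /orP[/eqP->|/eqP->].
    by rewrite eqxx.
  by rewrite lm eqxx.
case/orP => /eqP[-> ->].
  rewrite !inE negbK => /orP[/eqP->|/eqP->]; first by rewrite eqxx.
  move=> li lm'; rewrite setC_label //.
  have [_ _ e3 e4] := inner_glueE li lm'.
  by rewrite imset_set2 e3 e4 finset.setUC eqxx orbT.
rewrite !inE negb_or => /andP[xi _] xl; rewrite mateK => xl'.
have -> : x = mate i.
  by move: il lm xi xl xl'; elim/I4E: i; elim/I4E: l; elim/I4E: x; rewrite !mateE.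
have h1 : mate i != mate l by rewrite (inj_eq perm_inj).
have h2 : mate i != mate (mate l) by rewrite mateK eq_sym.
have [e1 _ _ e4] := inner_glueE h1 h2.
rewrite imset_set2 mateK in e4 *; rewrite e1 e4.
by rewrite setC_label // finset.setUC eqxx.
Qed.

Lemma outer_class_connect b i l d : i != l -> d \in outer_class b i l ->
  connect (@edge_rel T) d =1 mem (outer_class b i l).
Proof.
move=> il; have il' : sperm G b i i != sperm G b i l by rewrite (inj_eq perm_inj).
move: d; apply: (@edge_classP T _ ((b, (true, i)), ~: [set i; l])).
  move=> d x; rewrite {1}/outer_class mem_cat => /orP[] dh xd.
    exact: outer_class_step.
  by rewrite -outer_class_swap; apply: outer_class_step.
move=> d; rewrite mem_cat => /orP[/outer_half_connect|/outer_half_connect]; first exact.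
move=> /(_ il') h; apply: connect_trans h _.
set i' := sperm G b i i; set l' := sperm G b i l; set b' := nbr G b i.
have := @outer_step b' true i' (~: [set i'; l']).
rewrite /b' /i' /l' nbrK spermK !permK !inE eqxx => /(_ isT) h.
apply: connect_trans h _; apply: outer_half_connect => //.
rewrite mem_outer_half /= eqxx.
have := corner_image b' i' l'; rewrite /b' /i' /l' spermK !permK => ->.
exact: mem_corners_head.
Qed.

End EdgeClasses.

(** * Gluing equations and block equations *)

(** With S the sum over l != i, each hypothesis says F j = S; summing over the three j gives S = 3
    S. *)
Lemma sum_but_two_eq0 (V : numDomainType) (F : 'I_4 -> V) (i : 'I_4) :
  (forall j, j != i -> \sum_(l | (l != i) && (l != j)) F l = 0) ->
  forall j, j != i -> F j = 0.
Proof.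
move=> F0; pose S := \sum_(l | l != i) F l.
have FE j : j != i -> F j = S by move=> ji; rewrite /S (bigD1 j) //= F0 // addr0.
suff S0 : S = 0 by move=> j /FE->.
have : S = S *+ 3.
  by rewrite {1}/S (eq_bigr (fun=> S)) // sumr_const cardC1 card_ord.
move/eqP; rewrite (mulrSr S 2) -subr_eq subrr eq_sym -mulr_natr mulf_eq0 pnatr_eq0 orbF.
by move/eqP.
Qed.

Local Notation arc_holonomy G z a :=
  (log_holonomy (@orient (fsl_triangulation G)) z (meridian a)).

Section GluingEquations.
Variables (R : realType) (c : nat) (G : fsl_gluing c).
Local Notation C := R[i].
Local Notation T := (fsl_triangulation G).
Variable z : 'I_c * block_tetra -> C.
Local Notation zb b := (fun a : block_tetra => z (b, a)).

Lemma uniq_central_class (b : 'I_c) s : uniq (central_class b s).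
Proof. by rewrite map_inj_uniq ?enum_uniq // => i j []. Qed.

Lemma uniq_outer_half (b : 'I_c) i l : i != l -> uniq (outer_half b i l).
Proof.
move=> il; apply: allpairs_uniq => //; last first.
  by move=> [s [a e]] [s' [a' e']] _ _ [-> -> ->].
rewrite /corners; case: ifPn => // lm; rewrite /= andbT inE xpair_eqE negb_and.
by apply/orP; left; apply: contra lm => /eqP->; rewrite mateK.
Qed.

(** By [corners_inj], the two halves could only meet if a sphere were glued to itself, which
    [nbr_neq] excludes. *)
Lemma uniq_outer_class b i l : i != l -> uniq (outer_class G b i l).
Proof.
move=> il; have il' : sperm G b i i != sperm G b i l by rewrite (inj_eq perm_inj).
rewrite cat_uniq !uniq_outer_half //= andbT.
apply/hasPn => d; rewrite !mem_outer_half => /andP[/eqP e1 c1].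
apply/negP => /andP[/eqP e2 c2].
have /eqP := nbr_neq G b i; apply; congr (_, _); first by rewrite -e1 e2.
exact: corners_inj c1 c2.
Qed.

Lemma mem_classes (t : tetra T) (e : {set 'I_4}) : #|e| = 2%N ->
  (exists b s, (t, e) \in central_class b s)
  \/ (exists b i l, i != l /\ (t, e) \in outer_class G b i l).
Proof.
case: t => b [s i] e2; have /eqP/cards2P[j [k [jk ->]]] := e2.
suff : [set j; k] = [set i; mate i]
    \/ exists i' l, i' != l /\ (i, [set j; k]) \in corners i' l.
  case=> [->|[i' [l [il ci]]]].
    by left; exists b, s; apply/mapP; exists i; rewrite ?mem_enum.
  by right; exists b, i', l; rewrite mem_outer_class /= eqxx ci.
(* An edge through the label i of the tetrahedron i ends on the central axis: it is the axis itself,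
   or the second corner of an outer edge. An edge avoiding i is the first corner of the outer edge
   (i, l), where l is the remaining label. *)
have at_i m : m != i -> [set i; m] = [set i; mate i]
    \/ exists i' l, i' != l /\ (i, [set i; m]) \in corners i' l.
  move=> mi; have [->|mm] := eqVneq m (mate i); first by left.
  right; exists m, (mate i); split=> //; rewrite /corners (inj_eq perm_inj).
  by rewrite eq_sym (negPf mi) mateK !inE finset.setUC eqxx orbT.
have [ji|ji] := eqVneq j i; first by rewrite ji; apply: at_i; rewrite -ji eq_sym.
have [ki|ki] := eqVneq k i; first by rewrite ki finset.setUC; apply: at_i.
right; have /eqP/cards1P[l lE] : #|~: [set i; j; k]| = 1%N.
  by rewrite cardsCs finset.setCK card_ord finset.setUC cardsU1 cards2 !inE
    negb_or ki !(eq_sym k) (eq_sym i) ji jk.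
have lP x : (x == l) = ~~ [|| x == i, x == j | x == k].
  by have /setP/(_ x) := lE; rewrite !inE orbA => <-.
exists i, l; split; first by rewrite lP eqxx.
suff -> : [set j; k] = ~: [set i; l] by exact: mem_corners_head.
apply/setP => x; rewrite !inE lP negb_or negbK.
have [->|//] := eqVneq x i.
by rewrite !(eq_sym i) (negPf ji) (negPf ki).
Qed.

Lemma sum_outer_half b i l : i != l ->
  \sum_(d <- outer_half b i l) clog (edge_param d.1.2.1 (z d.1) d.2)
    = edge_angle (zb b) i l.
Proof.
move=> il; rewrite /edge_angle /outer_half big_allpairs_dep /= big_bool.
rewrite big_cons big_seq1 /= /corners; case: ifPn => [/eqP lm|lm].
  rewrite !big_seq1 /corner /=.
  have -> : ~: [set i; l] = [set (i + 2)%R; mate (i + 2)%R]; last by [].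
  apply/setP => x; rewrite !inE lm.
  by elim/I4E: i {lm il}; elim/I4E: x; rewrite ?I4_add2 !mateE.
by rewrite !big_cons !big_nil /= !addr0 setC_label.
Qed.

Lemma edge_equationsP : edge_equations (T := T) z <->
  (forall b, central_equations (zb b)) /\
  (forall b i l, i != l ->
     edge_angle (zb b) i l
     + edge_angle (zb (nbr G b i)) (sperm G b i i) (sperm G b i l) = two_pi_i R).
Proof.
pose F (d : tetra T * {set 'I_4}) := clog (edge_param (orient (i := T) d.1) (z d.1) d.2).
have sumC b s : \sum_(d <- central_class b s) F d = \sum_i clog (z (b, (s, i))).
  rewrite big_map big_enum; apply: eq_bigr => i _; rewrite /F /= edge_paramE; last first.
    by rewrite eq_sym mate_neq.
  by elim/I4E: i; rewrite !mateE.
have sumO b i l : i != l -> \sum_(d <- outer_class G b i l) F d = edge_angle (zb b) i l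
     + edge_angle (zb (nbr G b i)) (sperm G b i i) (sperm G b i l).
  move=> il; have il' : sperm G b i i != sperm G b i l by rewrite (inj_eq perm_inj).
  by rewrite big_cat /= -!sum_outer_half.
have sumE s d : uniq s -> connect (@edge_rel T) d =1 mem s ->
    \sum_(d' | connect (@edge_rel T) d d') F d' = \sum_(d' <- s) F d'.
  by move=> us es; rewrite big_uniq //; apply: eq_bigl.
split=> [eqs|[cen out] [t e] /= /mem_classes-/(_ t)[[b [s de]]|[b [i [l [il de]]]]]].
- split=> [b s|b i l il].
    pose d := ((b, (s, 0)), [set 0; mate 0]) : tetra T * {set 'I_4}.
    rewrite -sumC -(sumE _ d (uniq_central_class b s) (central_class_connect _)).
      by apply: eqs; rewrite cards2 eq_sym mate_neq.
    by apply/mapP; exists 0; rewrite ?mem_enum.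
  pose d := ((b, (true, i)), ~: [set i; l]) : tetra T * {set 'I_4}.
  rewrite -sumO // -(sumE _ d (uniq_outer_class b il) (outer_class_connect il _)).
    by apply: eqs; rewrite cardsCs finset.setCK cards2 il card_ord.
  by rewrite mem_outer_class /= eqxx mem_corners_head.
- rewrite (sumE _ _ (uniq_central_class b s) (central_class_connect de)) sumC.
  exact: cen.
- by rewrite (sumE _ _ (uniq_outer_class b il) (outer_class_connect il de)) sumO // out.
Qed.

Local Notation hol a := (arc_holonomy G z a).

Lemma meridian_holonomyE (a : link_arc c) :
  hol a = log_holonomy fst (zb a.1.1) (block_meridian a.1.2 a.2).
Proof. by rewrite /log_holonomy /meridian big_map. Qed.

Lemma proper_next_arc (a : link_arc c) : proper_arc a -> proper_arc (next_arc G a).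
Proof. by case: a => -[b i] j; rewrite /proper_arc /= (inj_eq perm_inj) eq_sym. Qed.

Lemma proper_rev_arc (a : link_arc c) : proper_arc a -> proper_arc (rev_arc a).
Proof. by rewrite /proper_arc /= eq_sym. Qed.

Hypothesis z_gt0 : positive_shapes z.

Lemma zb_gt0 b : positive_shapes (zb b).
Proof. by move=> a; apply: z_gt0. Qed.

Hypothesis z_central : forall b, central_equations (zb b).

Lemma hol_tail (b : 'I_c) i j : i != j -> hol ((b, i), j)
  = two_pi_i R - \sum_(l | (l != i) && (l != j)) edge_angle (zb b) i l.
Proof.
move=> ij; rewrite meridian_holonomyE.
by case: (block_holonomyE (zb_gt0 b) (z_central b) ij).
Qed.

Lemma hol_head (b : 'I_c) i j : i != j -> hol ((b, i), j)
  = \sum_(l | (l != i) && (l != j)) edge_angle (zb b) j l - two_pi_i R.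
Proof.
move=> ij; rewrite meridian_holonomyE.
by case: (block_holonomyE (zb_gt0 b) (z_central b) ij).
Qed.

(** Reversal exchanges the ends of an arc, and the formulas at the tail and at the head are
    opposite. *)
Lemma hol_rev_arc a : proper_arc a -> hol (rev_arc a) = - hol a.
Proof.
case: a => -[b i] j ij; rewrite hol_head ?hol_tail // 1?eq_sym // opprB.
by congr (_ - _); apply: eq_bigl => l; rewrite andbC.
Qed.

(** The head formula for the arc and the tail formula for its successor concern the two sides of one
    sphere; their two constants 2 pi i are shared between the two terms of the sum. *)
Lemma hol_next_arc_diff b i j : j != i ->
  hol (next_arc G ((b, j), i)) - hol ((b, j), i)
  = - \sum_(l | (l != i) && (l != j)) (edge_angle (zb b) i l
     + edge_angle (zb (nbr G b i)) (sperm G b i i) (sperm G b i l) - two_pi_i R).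
Proof.
move=> ji; rewrite /= hol_tail; last by rewrite (inj_eq perm_inj) eq_sym.
rewrite hol_head // (reindex_inj (@perm_inj _ (sperm G b i))) /=.
under eq_bigl do rewrite !(inj_eq perm_inj).
under [X in _ - (X - _)]eq_bigl do rewrite andbC.
rewrite !big_split /= sumr_const.
have -> : #|[pred l | (l != i) && (l != j)]| = 2%N.
  transitivity #|~: [set i; j]|; first by apply: eq_card => l; rewrite !inE negb_or.
  by have := cardsC [set i; j]; rewrite cards2 (eq_sym i) ji card_ord; case.
by rewrite mulr2n; ring.
Qed.

End GluingEquations.

Lemma gluing_equationP (R : realType) c (G : fsl_gluing c) (M : {set link_arc c})
    (H : link_arc c -> R[i]) (z : 'I_c * block_tetra -> R[i]) :
  meridian_system G M -> link_holonomy G H -> positive_shapes z ->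
  (gluing_equation G M H z <->
   forall b, block_equations (fun i j => H (b, i, j)) (fun a => z (b, a))).
Proof.
move=> [Mpr Mall] [Hrev Hnext] z0; split.
  case=> /edge_equationsP[cen out] hM b; split=> [|i j ij]; first exact: cen.
  have hnext a : proper_arc a -> arc_holonomy G z (next_arc G a)
       = arc_holonomy G z a.
    case: a => -[b' i'] j' ij'; apply/eqP; rewrite -subr_eq0 hol_next_arc_diff //.
    rewrite big1 ?oppr0 // => l /andP[lj _].
    by rewrite out ?subrr // eq_sym.
  have orb a n : proper_arc a -> let m := iter n (next_arc G) a in
     [/\ proper_arc m, H m = H a
       & arc_holonomy G z m = arc_holonomy G z a].
    move=> pa; elim: n => [|n [pm Hm hm]] //=.
    by rewrite proper_next_arc ?Hnext ?hnext.
  have conn a m : proper_arc a -> m \in M -> fconnect (next_arc G) a m ->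
      arc_holonomy G z a = H a.
    move=> pa mM /iter_findex e; have [_] := orb a (findex (next_arc G) a m) pa.
    by rewrite e hM // => -> ->.
  have pa : proper_arc (b, i, j) by rewrite /proper_arc /= neq_ltn ij.
  (* The chosen meridian of the component may belong to the opposite orientation; the signs of both
     holonomies then change. *)
  have [m mM /orP[am|am]] := Mall _ pa.
    by rewrite -(conn _ _ pa mM am) meridian_holonomyE.
  have := conn _ _ (proper_rev_arc pa) mM am.
  by rewrite Hrev hol_rev_arc // => /oppr_inj; rewrite meridian_holonomyE.
move=> blk; have cen b : central_equations (fun a => z (b, a)) by case: (blk b).
have hE a : proper_arc a -> arc_holonomy G z a = H a.
  case: a => -[b i] j; rewrite /proper_arc /= neq_ltn => /orP[] ij.
    by rewrite meridian_holonomyE; case: (blk b) => _ /(_ _ _ ij).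
  have pa : proper_arc (b, j, i) by rewrite /proper_arc /= neq_ltn ij.
  have e : arc_holonomy G z (b, j, i) = H (b, j, i).
    by rewrite meridian_holonomyE; case: (blk b) => _ /(_ _ _ ij).
  have := hol_rev_arc G z0 cen pa; rewrite e -Hrev; exact.
split; last by move=> m /Mpr; apply: hE.
apply/edge_equationsP; split=> // b i l il.
(* Each pairwise sum of the defects on the i-th sphere is, up to sign, the jump of the holonomy from
   one arc to the next, and this jump is 0. *)
apply/eqP; rewrite -subr_eq0; apply/eqP; rewrite eq_sym in il.
move: l il; apply: sum_but_two_eq0 => j ji.
have pa : proper_arc (b, j, i) by [].
apply/eqP; rewrite -oppr_eq0 -hol_next_arc_diff //.
by rewrite !hE ?proper_next_arc // Hnext // subrr.
Qed.

(** * Limits of complex functions *)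

Section ComplexLimits.
Import numFieldNormedType.Exports.
Local Open Scope classical_set_scope.
Variables (R : realType) (X : Type) (F : set_system X).
Context {FF : Filter F}.
Local Notation C := R[i].
Implicit Types (f g : X -> C) (l m : C).

(** Convergence is taken componentwise so that real limit theorems apply; [cvgCP] recovers the form
    with the modulus. *)
Definition cvgC f l : Prop :=
  ((fun x => complex.Re (f x)) @ F --> complex.Re l) /\
  ((fun x => complex.Im (f x)) @ F --> complex.Im l).

Lemma cvgC_ext f g l : f =1 g -> cvgC g l -> cvgC f l.
Proof. by move=> /funext->. Qed.

Lemma cvgC_cst l : cvgC (fun=> l) l.
Proof. by split; apply: cvg_cst. Qed.

Lemma cvgC_D f g l m : cvgC f l -> cvgC g m -> cvgC (fun x => f x + g x) (l + m).
Proof.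
move=> [fr fi] [gr gi]; split.
  rewrite (_ : (fun x => _) = (fun x => complex.Re (f x)) + (fun x => complex.Re (g x))).
    by rewrite ReD; apply: cvgD.
  by apply/funext => x; rewrite ReD.
rewrite (_ : (fun x => _) = (fun x => complex.Im (f x)) + (fun x => complex.Im (g x))).
  by rewrite ImD; apply: cvgD.
by apply/funext => x; rewrite ImD.
Qed.

Lemma cvgC_N f l : cvgC f l -> cvgC (fun x => - f x) (- l).
Proof.
move=> [fr fi]; split.
  rewrite (_ : (fun x => _) = - (fun x => complex.Re (f x))).
    by rewrite ReN; apply: cvgN.
  by apply/funext => x; rewrite ReN.
rewrite (_ : (fun x => _) = - (fun x => complex.Im (f x))).
  by rewrite ImN; apply: cvgN.
by apply/funext => x; rewrite ImN.
Qed.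

Lemma cvgC_B f g l m : cvgC f l -> cvgC g m -> cvgC (fun x => f x - g x) (l - m).
Proof. by move=> fl gm; apply: cvgC_D fl (cvgC_N gm). Qed.

Lemma cvgC_M f g l m : cvgC f l -> cvgC g m -> cvgC (fun x => f x * g x) (l * m).
Proof.
move=> [fr fi] [gr gi]; split.
  rewrite (_ : (fun x => _) = (fun x => complex.Re (f x)) * (fun x => complex.Re (g x))
     - (fun x => complex.Im (f x)) * (fun x => complex.Im (g x))).
    by rewrite ReM; apply: cvgB; apply: cvgM.
  by apply/funext => x; rewrite ReM.
rewrite (_ : (fun x => _) = (fun x => complex.Re (f x)) * (fun x => complex.Im (g x))
     + (fun x => complex.Im (f x)) * (fun x => complex.Re (g x))).
  by rewrite ImM; apply: cvgD; apply: cvgM.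
by apply/funext => x; rewrite ImM.
Qed.

Lemma cvgC_V f l : l != 0 -> cvgC f l -> cvgC (fun x => (f x)^-1) l^-1.
Proof.
move=> l0 [fr fi].
have q : (fun x => (sqnorm (f x))^-1) @ F --> (sqnorm l)^-1.
  apply: cvgV; first by rewrite gt_eqF ?sqnorm_gt0.
  rewrite (_ : (fun x => _) = (fun x => complex.Re (f x)) * (fun x => complex.Re (f x))
     + (fun x => complex.Im (f x)) * (fun x => complex.Im (f x))).
    by apply: cvgD; apply: cvgM.
  by [].
split.
  rewrite (_ : (fun x => _) = (fun x => complex.Re (f x)) * (fun x => (sqnorm (f x))^-1)).
    by rewrite ReV; apply: cvgM.
  by apply/funext => x; rewrite ReV.
rewrite (_ : (fun x => _) = - (fun x => complex.Im (f x)) * (fun x => (sqnorm (f x))^-1)).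
  by rewrite ImV; apply: cvgM => //; apply: cvgN.
by apply/funext => x; rewrite ImV.
Qed.

Lemma cvgC_div f g l m : m != 0 -> cvgC f l -> cvgC g m -> cvgC (fun x => f x / g x) (l / m).
Proof. by move=> m0 fl gm; apply: cvgC_M fl (cvgC_V m0 gm). Qed.

Lemma cvgC_sum (I : Type) (r : seq I) (P : pred I) (f : I -> X -> C) (l : I -> C) :
  (forall i, cvgC (f i) (l i)) ->
  cvgC (fun x => \sum_(i <- r | P i) f i x) (\sum_(i <- r | P i) l i).
Proof.
move=> fl; elim: r => [|i r ih].
  by rewrite big_nil; apply: cvgC_ext (cvgC_cst _) => x; rewrite big_nil.
rewrite big_cons; apply: (@cvgC_ext _ (fun x => if P i then f i x + \sum_(i <- r | P i) f i x
  else \sum_(i <- r | P i) f i x)) => [x|]; first by rewrite big_cons.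
by case: (P i) => //; apply: cvgC_D.
Qed.

Lemma cvgC_prod (I : Type) (r : seq I) (P : pred I) (f : I -> X -> C) (l : I -> C) :
  (forall i, cvgC (f i) (l i)) ->
  cvgC (fun x => \prod_(i <- r | P i) f i x) (\prod_(i <- r | P i) l i).
Proof.
move=> fl; elim: r => [|i r ih].
  by rewrite big_nil; apply: cvgC_ext (cvgC_cst _) => x; rewrite big_nil.
rewrite big_cons; apply: (@cvgC_ext _ (fun x => if P i then f i x * \prod_(i <- r | P i) f i x
  else \prod_(i <- r | P i) f i x)) => [x|]; first by rewrite big_cons.
by case: (P i) => //; apply: cvgC_M.
Qed.

Lemma cvgC_cexp f l : cvgC f l -> cvgC (fun x => cexp (f x)) (cexp l).
Proof.
move=> [fr fi].
have er : (fun x => expR (complex.Re (f x))) @ F --> expR (complex.Re l).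
  exact: (continuous_cvg _ (@continuous_expR R _) fr).
have ec : (fun x => cos (complex.Im (f x))) @ F --> cos (complex.Im l).
  exact: (continuous_cvg _ (@continuous_cos R _) fi).
have es : (fun x => sin (complex.Im (f x))) @ F --> sin (complex.Im l).
  exact: (continuous_cvg _ (@continuous_sin R _) fi).
split.
  rewrite (_ : (fun x => _) = (fun x => expR (complex.Re (f x))) * (fun x => cos (complex.Im (f x)))).
    by rewrite /cexp ReM /= mul0r subr0; apply: cvgM.
  by apply/funext => x; rewrite /cexp ReM /= mul0r subr0.
rewrite (_ : (fun x => _) = (fun x => expR (complex.Re (f x))) * (fun x => sin (complex.Im (f x)))).
  by rewrite /cexp ImM /= mul0r addr0; apply: cvgM.
by apply/funext => x; rewrite /cexp ImM /= mul0r addr0.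
Qed.

Lemma normc_le_ReIm (z : C) : normc z <= `|complex.Re z| + `|complex.Im z|.
Proof.
rewrite normc_sqrt -[leRHS]ger0_norm ?addr_ge0 // -sqrtr_sqr; apply: ler_wsqrtr.
rewrite /sqnorm sqrrD !real_normK ?num_real // addrAC lerDl.
by rewrite mulrn_wge0 // mulr_ge0.
Qed.

Lemma cvgCP f l : cvgC f l <->
  forall e : R, 0 < e -> \forall x \near F, normc (f x - l) < e.
Proof.
split=> [[/cvgrPdist_lt fr /cvgrPdist_lt fi] e e0|h].
  have e2 : 0 < e / 2 by rewrite divr_gt0.
  have hr := fr _ e2; have hi := fi _ e2; near=> x.
  apply: le_lt_trans (normc_le_ReIm _) _; rewrite ReD ImD ReN ImN.
  rewrite -(distrC (complex.Re l)) -(distrC (complex.Im l)) [e]splitr ltrD //.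
    by near: x; apply: hr.
  by near: x; apply: hi.
split; apply/cvgrPdist_lt => e /h; apply: filterS => x; apply: le_lt_trans;
  rewrite distrC.
  by rewrite -ReN -ReD; apply: le_Re_normc.
by rewrite -ImN -ImD; apply: le_Im_normc.
Unshelve. all: by end_near.
Qed.

Lemma Im_sqrtC_ge0 (z : C) : 0 <= complex.Im (sqrtC z).
Proof. by have := Im_rootC_ge0 z (isT : (1 < 2)%N); rewrite -complexIm ler0c. Qed.

(** Both roots have nonnegative imaginary part, so their sum has modulus at least Im ([sqrtC l]) >
    0, and their difference is f - l divided by this sum. *)
Lemma cvgC_sqrtC f l : 0 < complex.Im (sqrtC l) -> cvgC f l ->
  cvgC (fun x => sqrtC (f x)) (sqrtC l).
Proof.
move=> s0 /cvgCP fl; apply/cvgCP => e e0.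
have := fl _ (mulr_gt0 e0 s0); apply: filterS => x.
have -> : f x - l = (sqrtC (f x) - sqrtC l) * (sqrtC (f x) + sqrtC l).
  by rewrite -subr_sqr !sqrtCK.
rewrite normcM => lt; rewrite -(ltr_pM2r s0); apply: le_lt_trans lt.
apply: ler_wpM2l; first by rewrite normc_sqrt sqrtr_ge0.
apply: le_trans (le_Im_normc _); rewrite ImD ger0_norm.
  by rewrite lerDr Im_sqrtC_ge0.
by rewrite addr_ge0 ?Im_sqrtC_ge0.
Qed.

Lemma near_Im_gt0 f l : 0 < complex.Im l -> cvgC f l ->
  \forall x \near F, 0 < complex.Im (f x).
Proof.
move=> l0 /cvgCP fl; have := fl _ l0; apply: filterS => x lt.
have := le_lt_trans (le_Im_normc _) lt.
by rewrite ImD ImN ltr_norml => /andP[+ _]; rewrite ltrBrDr addNr.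
Qed.

Lemma near_Re_gt0 f l : 0 < complex.Re l -> cvgC f l ->
  \forall x \near F, 0 < complex.Re (f x).
Proof.
move=> l0 /cvgCP fl; have := fl _ l0; apply: filterS => x lt.
have := le_lt_trans (le_Re_normc _) lt.
by rewrite ReD ReN ltr_norml => /andP[+ _]; rewrite ltrBrDr addNr.
Qed.

Lemma near_neq f l m : l != m -> cvgC f l -> \forall x \near F, f x != m.
Proof.
move=> lm /cvgCP fl; have n0 : 0 < normc (l - m) by rewrite normc_gt0 // subr_eq0.
have := fl _ n0; apply: filterS => x lt; apply: contraTneq lt => ->.
by rewrite -normcN opprB ltxx.
Qed.

End ComplexLimits.

(** * Solution of the block equations *)

Section LogarithmicSystem.
Variable R : realType.
Local Notation C := R[i].
Variables (h : 'I_4 -> 'I_4 -> C) (z : block_tetra -> C).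

(** [x_log] and [y_log] are the exponents of the coefficients x_i and y_i in [block_solution]. *)
Definition x_log (i : 'I_4) : C :=
  [:: h 0 2; h 0 1 + h 2 3 + h 1 3; - h 0 2; h 0 1 + h 2 3 - h 1 3]`_i / 2.

Definition y_log (i : 'I_4) : C :=
  [:: h 0 1 - h 0 3; h 2 3 - h 1 2; h 2 3 + h 1 2; h 0 1 + h 0 3]`_i / 2.

(* With t = cexp tau, this says that X_i = x_i t and Y_i = - (y_i t)^-1 in terms
   of logarithms. *)
Definition log_system (tau : C) : Prop := forall i,
  clog (shape' (z (true, i))) + clog (shape'' (z (false, i))) = tau + x_log i /\
  clog (shape'' (z (true, i))) + clog (shape' (z (false, i)))
    = Complex 0 pi - tau - y_log i.

Hypothesis z_gt0 : positive_shapes z.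

Let P : C := Complex 0 pi.

Let PE : two_pi_i R = P + P.
Proof. by apply: complexP; rewrite /= ?addr0 // mulr2n. Qed.

Let zE s k : clog (shape'' (z (s, k))) = P - clog (z (s, k)) - clog (shape' (z (s, k))).
Proof. by rewrite /P -(clog_shapes (z_gt0 (s, k))); ring. Qed.

Lemma block_equations_log_system : block_equations h z ->
  exists tau, log_system tau.
Proof.
(* This value of tau is forced by the equation for X_0; the other equations are then linear
   consequences of the block equations. *)
move=> [cen hol]; exists
  (clog (shape' (z (true, 0))) + clog (shape'' (z (false, 0))) - x_log 0).
have cE s : clog (z (s, 3)) = P + P - clog (z (s, 0))
    - clog (z (s, 1)) - clog (z (s, 2)).
  by rewrite -PE -(cen s) sumI4; ring.
move=> i; rewrite /x_log /y_log -!hol //.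
rewrite /log_holonomy /block_meridian /half_meridian -/P.
rewrite !mateE /= ?I4_add2 ?mateE !big_cons !big_nil /= !edge_paramE //=.
by elim/I4E: i => /=; rewrite ?zE ?cE; split; field.
Qed.

(** One central equation suffices as input: the system gives log z_i + log w_i = pi i + y_log i -
    x_log i, and the sums of [x_log] and [y_log] over i agree, so the other central equation
    follows. *)
Lemma log_system_block_equations tau :
  \sum_i clog (z (false, i)) = two_pi_i R -> log_system tau ->
  block_equations h z.
Proof.
move=> cf ls.
have cE : clog (z (false, 3)) = P + P - clog (z (false, 0))
    - clog (z (false, 1)) - clog (z (false, 2)).
  by rewrite -PE -cf sumI4; ring.
have l'E i : clog (shape' (z (true, i))) = tau + x_log i - P
    + clog (z (false, i)) + clog (shape' (z (false, i))).
  have [<- _] := ls i; rewrite zE; ring.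
have lE i : clog (z (true, i)) = y_log i - x_log i + P - clog (z (false, i)).
  have [_] := ls i; rewrite zE l'E -/P => e.
  suff -> : y_log i = P - tau - (P - tau - y_log i) by rewrite -e; ring.
  by ring.
split=> [[]|i j]; last 1 first.
- rewrite /log_holonomy /block_meridian /half_meridian.
  elim/I4E: i; elim/I4E: j => // _;
  rewrite !mateE /= ?I4_add2 ?mateE !big_cons !big_nil /= !edge_paramE //=
    ?zE ?l'E ?lE ?cE /x_log /y_log /=; by field.
- by rewrite sumI4 !lE cE PE /x_log /y_log /=; field.
- exact: cf.
Qed.

End LogarithmicSystem.

(** * Passing between the shapes and the products X and Y *)

Section ShapeAlgebra.
Variable K : fieldType.
Implicit Types a b t x y z w : K.

(* Here a = x * t and b = y * t, that is, X = a and Y = - b^-1. *)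
Lemma shapes_of_products z w a b : z != 0 -> w != 0 -> 1 - z != 0 ->
  1 - w != 0 -> 1 - z * w != 0 -> b != 0 ->
  (1 - z)^-1 * (1 - w^-1) = a -> (1 - z^-1) * (1 - w)^-1 = - b^-1 ->
  [/\ 1 - a != 0, 1 + b != 0, z = b * (a - 1) / (a * (1 + b))
    & w = (1 + b) / (1 - a)].
Proof.
move=> z0 w0 z1 w1 zw b0 <- be.
have -> : b = z * (1 - w) / (1 - z).
  have -> : b = - (- b^-1)^-1 by rewrite invrN invrK opprK.
  rewrite -be; field; rewrite z0 w1 z1 /=.
  by rewrite -opprB oppr_eq0 z1.
(* Both 1 - a and 1 + b are multiples of 1 - z w, and their quotient is w. *)
have e1 : 1 - (1 - z)^-1 * (1 - w^-1) = (1 - z * w) / (w * (1 - z)).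
  by field; rewrite w0 z1.
have e2 : 1 + z * (1 - w) / (1 - z) = (1 - z * w) / (1 - z) by field.
have n1 : 1 - (1 - z)^-1 * (1 - w^-1) != 0.
  by rewrite e1 !mulf_neq0 ?invr_eq0 ?mulf_neq0.
have n2 : 1 + z * (1 - w) / (1 - z) != 0.
  by rewrite e2 !mulf_neq0 ?invr_eq0.
split=> //; last by rewrite e1 e2; field; rewrite w0 z1 zw.
rewrite -[_ * _ - 1]opprB e1 e2; field.
by rewrite w0 z1 zw /= -opprB oppr_eq0 w1.
Qed.

(** Both 1 - z and 1 - w contain the factor x + y, which keeps the shapes away from 1 and cancels in
    the products. *)
Lemma products_of_shapes x y t : x != 0 -> y != 0 -> t != 0 -> x + y != 0 ->
  1 - x * t != 0 -> 1 + y * t != 0 ->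
  let z := y * (x * t - 1) / (x * (1 + y * t)) in
  let w := (1 + y * t) / (1 - x * t) in
  (1 - z)^-1 * (1 - w^-1) = x * t /\ (1 - z^-1) * (1 - w)^-1 = - (y * t)^-1.
Proof.
move=> x0 y0 t0 xy a1 b1 z w.
have a1' : x * t - 1 != 0 by rewrite -opprB oppr_eq0.
have -> : 1 - z = (x + y) / (x * (1 + y * t)) by rewrite /z; field; rewrite x0 b1.
have -> : 1 - w^-1 = (x + y) * t / (1 + y * t) by rewrite /w; field; rewrite a1 b1.
have -> : 1 - z^-1 = - (x + y) / (y * (x * t - 1)).
  by rewrite /z; field; rewrite x0 y0 a1' b1.
have -> : 1 - w = - ((x + y) * t) / (1 - x * t) by rewrite /w; field.
by split; field; rewrite ?x0 ?y0 ?t0 ?xy ?a1 ?b1 //= oppr_eq0 mulf_neq0.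
Qed.

End ShapeAlgebra.

(** * The quadratic equation for the unknown t *)

Section BlockRoot.
Variable R : realType.
Local Notation C := R[i].
Implicit Types (x y u : 'I_4 -> C) (t : C).

Lemma prod_1addM u t : \prod_i (1 + u i * t)
  = 1 + sym1 u * t + sym2 u * t ^+ 2 + sym3 u * t ^+ 3 + (\prod_i u i) * t ^+ 4.
Proof.
rewrite /sym1 /sym2 /sym3 !sumI4 !prodI4.
do 4 rewrite big_mkcond sumI4 /=; do 4 rewrite big_mkcond prodI4 /=.
by ring.
Qed.

Definition discriminant x y : C :=
  (sym2 x - sym2 y) ^+ 2 - 4 * (sym3 x + sym3 y) * (sym1 x + sym1 y).

(** The sign [e] is 1 for the root used in [block_solution] and -1 for the spurious one. *)
Definition quadratic_root (e : C) x y : C :=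
  (sym2 x - sym2 y + e * sqrtC (discriminant x y)) / (2 * (sym3 x + sym3 y)).

(** The two quartics have the same constant term, and the same leading coefficient because the
    products agree; dividing their difference by t leaves a quadratic equation. *)
Lemma quadratic_rootP x y t : t != 0 -> sym3 x + sym3 y != 0 ->
  \prod_i x i = \prod_i y i ->
  (\prod_i (1 + y i * t) = \prod_i (1 - x i * t) <->
   t = quadratic_root 1 x y \/ t = quadratic_root (-1) x y).
Proof.
move=> t0 A0 xy; have n2 : 2 != 0 :> C by rewrite pnatr_eq0.
set A := sym3 x + sym3 y; pose B := sym2 x - sym2 y; pose D := sym1 x + sym1 y.
have e : \prod_i (1 - x i * t) = \prod_i (1 + x i * (- t)).
  by apply: eq_bigr => i _; rewrite mulrN.
rewrite e !prod_1addM xy.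
have sq : (2 * A * t - B) ^+ 2 - discriminant x y = 4 * A * (A * t ^+ 2 - B * t + D).
  by rewrite /discriminant -/A -/B -/D; ring.
have disc0 : (A * t ^+ 2 - B * t + D = 0) <->
    t = quadratic_root 1 x y \/ t = quadratic_root (-1) x y.
  have -> : (A * t ^+ 2 - B * t + D = 0) <->
      (2 * A * t - B) ^+ 2 = sqrtC (discriminant x y) ^+ 2.
    rewrite sqrtCK; split=> [q|/eqP]; first by apply/eqP; rewrite -subr_eq0 sq q mulr0.
    rewrite -subr_eq0 sq mulf_eq0 mulf_eq0 pnatr_eq0 (negPf A0) /=.
    by move/eqP.
  have n2A : 2 * A != 0 by rewrite mulf_neq0.
  have tE s : 2 * A * t - B = s <-> t = (B + s) / (2 * A).
    split=> [<-|->]; first by field; rewrite A0.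
    by field; rewrite A0.
  rewrite /quadratic_root -/A -/B mul1r mulN1r -!tE.
  split=> [/eqP|[->|->]]; rewrite ?sqrrN //.
  by rewrite eqf_sqr => /orP[]/eqP->; [left|right].
rewrite -disc0; split=> [h|h].
  apply: (mulfI t0); rewrite mulr0 /A /B /D.
  by move/eqP: h; rewrite -subr_eq0 => /eqP <-; ring.
apply/eqP; rewrite -subr_eq0; apply/eqP.
by rewrite -[RHS](mulr0 t) -h /A /B /D; ring.
Qed.

(* [block_solution] with an arbitrary root t of the quadratic equation. *)
Definition solution_at x y t (a : block_tetra) : C :=
  if a.1 then y a.2 * (x a.2 * t - 1) / (x a.2 * (1 + y a.2 * t))
  else (1 + y a.2 * t) / (1 - x a.2 * t).

Lemma block_solutionE h a : block_solution h a =
  solution_at (fun i => cexp (x_log h i)) (fun i => cexp (y_log h i))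
    (quadratic_root 1 (fun i => cexp (x_log h i)) (fun i => cexp (y_log h i))) a.
Proof. by case: a => [[] i]; rewrite /quadratic_root mul1r. Qed.

End BlockRoot.

(** * Uniqueness and existence on one block *)

Section BlockSolution.
Variable R : realType.
Local Notation C := R[i].
Variable h : 'I_4 -> 'I_4 -> C.
Local Notation x := (fun i => cexp (x_log h i)).
Local Notation y := (fun i => cexp (y_log h i)).

Lemma prod_x_y : \prod_i x i = \prod_i y i.
Proof.
rewrite -!cexp_sum; congr cexp; rewrite !sumI4 /x_log /y_log /=.
by field.
Qed.

(** The inverse of a point of the upper half-plane lies in the lower one. *)
Lemma mulr_Im_neq1 (z w : C) : 0 < complex.Im z -> 0 < complex.Im w -> 1 - z * w != 0.
Proof.
move=> z0 w0; have zn := Im_neq0 z0; rewrite subr_eq0; apply: contraTneq w0 => e.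
have -> : w = z^-1 by apply: (mulfI zn); rewrite -e mulfV.
by rewrite ImV mulNr -leNgt oppr_le0 ltW // divr_gt0 // sqnorm_gt0.
Qed.

Lemma block_equations_unique (z : block_tetra -> C) :
  sym3 x + sym3 y != 0 ->
  complex.Im (solution_at x y (quadratic_root (-1) x y) (true, 0)) <= 0 ->
  positive_shapes z -> block_equations h z -> z =1 block_solution h.
Proof.
move=> A0 neg z0 eqs; have [cen _] := eqs.
have [tau ls] := block_equations_log_system z0 eqs.
pose t := cexp tau; have t0 : t != 0 := cexp_neq0 tau.
have zE i : [/\ 1 - x i * t != 0, 1 + y i * t != 0,
    z (true, i) = solution_at x y t (true, i)
    & z (false, i) = solution_at x y t (false, i)].
  have [e1 e2] := ls i.
  have nz a : z a != 0 := Im_neq0 (z0 a).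
  have nz1 a : 1 - z a != 0 := Im_neq1 (z0 a).
  have X : (1 - z (true, i))^-1 * (1 - (z (false, i))^-1) = x i * t.
    have -> : x i * t = cexp (tau + x_log h i) by rewrite cexpD mulrC.
    rewrite -e1 cexpD !clogK //; apply: Im_neq0; [exact: Im_shape'' | exact: Im_shape'].
  have Y : (1 - (z (true, i))^-1) * (1 - z (false, i))^-1 = - (y i * t)^-1.
    have -> : - (y i * t)^-1 = cexp (Complex 0 pi - tau - y_log h i).
      by rewrite !cexpD !cexpN cexp_pi_i invfM; ring.
    rewrite -e2 cexpD !clogK //; apply: Im_neq0; [exact: Im_shape' | exact: Im_shape''].
  have b0 : y i * t != 0 by rewrite mulf_neq0 ?cexp_neq0.
  have zw := mulr_Im_neq1 (z0 (true, i)) (z0 (false, i)).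
  have [n1 n2 ez ew] := shapes_of_products (nz _) (nz _) (nz1 _) (nz1 _) zw b0 X Y.
  split=> //; rewrite ez /solution_at /=; field.
  by rewrite t0 n2 cexp_neq0.
(* The central equation of the octahedron [false] says that the product of the w_i is 1. *)
have prod1 : \prod_i (1 + y i * t) = \prod_i (1 - x i * t).
  have d0 : \prod_i (1 - x i * t) != 0 by apply/prodf_neq0 => i _; case: (zE i).
  rewrite -[LHS](divfK d0) -[RHS]mul1r; congr (_ * _).
  rewrite -prodf_div -[RHS]cexp_2pi_i -(cen false) cexp_sum; apply: eq_bigr => i _.
  by rewrite clogK ?Im_neq0 //; case: (zE i) => _ _ _ ->.
have [tE|tE] := (quadratic_rootP t0 A0 prod_x_y).1 prod1.
  by case=> [[] i]; rewrite block_solutionE -tE; case: (zE i).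
(* The other root would give a shape that is not in the upper half-plane. *)
have [_ _ e _] := zE 0; move: neg; rewrite -tE -e leNgt.
by rewrite z0.
Qed.

Lemma block_solution_equations :
  let t := quadratic_root 1 x y in
  sym3 x + sym3 y != 0 -> 0 < complex.Im t ->
  (forall i, 1 - x i * t != 0) -> (forall i, 1 + y i * t != 0) ->
  (forall i, x i + y i != 0) ->
  (forall i, `|complex.Im (x_log h i)| < 1) ->
  (forall i, `|complex.Im (y_log h i)| < 1) ->
  positive_shapes (block_solution h) ->
  (forall a, 0 < complex.Re (shape' (block_solution h a))) ->
  (forall a, 0 < complex.Re (shape'' (block_solution h a))) ->
  block_equations h (block_solution h).
Proof.
move=> t A0 It a1 b1 xy lx ly z0 r1 r2.
have t0 : t != 0 := Im_neq0 It.
have pi2 := pi_ge2 R.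
have prod1 : \prod_i (1 + y i * t) = \prod_i (1 - x i * t).
  by apply/(quadratic_rootP t0 A0 prod_x_y); left.
have zE a : block_solution h a = solution_at x y t a := block_solutionE h a.
move: (block_solution h) zE z0 r1 r2 => z zE z0 r1 r2.
have za a := carg_gt0 (z0 a).
have z1a a : 0 < carg (shape' (z a)) < pi / 2.
  by have /andP[-> _] := carg_gt0 (Im_shape' (z0 a)); rewrite carg_lt_pihalf ?Im_shape'.
have z2a a : 0 < carg (shape'' (z a)) < pi / 2.
  by have /andP[-> _] := carg_gt0 (Im_shape'' (z0 a)); rewrite carg_lt_pihalf ?Im_shape''.
have /andP[ta1 ta2] := carg_gt0 It.
apply: (@log_system_block_equations _ h z z0 (clog t)).
  (* The quadratic equation makes the product of the w_i equal to 1; the four arguments lie in ]0,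
     pi[, so their sum can only be 2 pi. *)
  apply: cexp_inj.
    rewrite cexp_2pi_i cexp_sum.
    under eq_bigr do rewrite clogK ?Im_neq0 // zE /solution_at /=.
    rewrite prodf_div prod1 divff //.
    by apply/prodf_neq0 => i _.
  rewrite sumI4 !ImD /= -[pi *+ 2]mulr_natr.
  have /andP[? ?] := za (false, 0); have /andP[? ?] := za (false, 1).
  have /andP[? ?] := za (false, 2); have /andP[? ?] := za (false, 3).
  by rewrite ltr_norml; apply/andP; split; lra.
move=> i.
have [X Y] := products_of_shapes (cexp_neq0 _) (cexp_neq0 _) t0 (xy i) (a1 i) (b1 i).
have /andP[? ?] := z1a (true, i); have /andP[? ?] := z1a (false, i).
have /andP[? ?] := z2a (true, i); have /andP[? ?] := z2a (false, i).
(* In both equations the left side has imaginary part in ]0, pi[ and the right side in ]-1, pi + 1[;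
   they differ by less than pi + 1, which is below 2 pi because pi >= 2. *)
have := lx i; have := ly i; rewrite !ltr_norml => /andP[? ?] /andP[? ?].
split; apply: cexp_inj.
- rewrite !cexpD !clogK ?Im_neq0 ?Im_shape' ?Im_shape'' //.
  by rewrite !zE /solution_at /shape' /shape'' /= X mulrC.
- rewrite !ImD /= ltr_norml -[pi *+ 2]mulr_natr; apply/andP; split; lra.
- rewrite !cexpD !cexpN !clogK ?Im_neq0 ?Im_shape' ?Im_shape'' // cexp_pi_i.
  by rewrite !zE /solution_at /shape' /shape'' /= Y invfM; ring.
- rewrite !ImD !ImN /= ltr_norml -[pi *+ 2]mulr_natr; apply/andP; split; lra.
Qed.

End BlockSolution.

(** * Behaviour near the complete structure *)

Section NearComplete.
Local Open Scope classical_set_scope.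
Variable R : realType.
Local Notation C := R[i].
Local Notation I := (Complex 0 1 : C).
Implicit Types (h : 'I_4 -> 'I_4 -> C).

(** Neighbourhoods of 0 in the space of the six holonomies, one entry i < j for each ideal
    vertex. *)
Definition near_zero : set_system ('I_4 -> 'I_4 -> C) :=
  filter_from [set d : R | 0 < d]
    (fun d => [set h | forall i j : 'I_4, (i < j)%N -> normc (h i j) < d]).

Global Instance near_zero_filter : Filter near_zero.
Proof.
apply: filter_from_filter; first by exists 1; rewrite /= ltr01.
move=> d d' /= d0 d0'; exists (Num.min d d'); first by rewrite /= lt_min d0.
by move=> h /= hd; split=> i j /hd; rewrite lt_min => /andP[].
Qed.

Lemma cvgC_coord (i j : 'I_4) : (i < j)%N -> cvgC near_zero (fun h => h i j) 0.
Proof.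
move=> ij; apply/cvgCP => e e0; exists e => // h /(_ _ _ ij).
by rewrite subr0.
Qed.

Lemma cvgC_eq (X : Type) (F : set_system X) (f : X -> C) (l m : C) :
  l = m -> cvgC F f l -> cvgC F f m.
Proof. by move->. Qed.

Lemma cvgC_logs i : cvgC near_zero (fun h => x_log h i) 0 /\
  cvgC near_zero (fun h => y_log h i) 0.
Proof.
have half (f : ('I_4 -> 'I_4 -> C) -> C) :
    cvgC near_zero f 0 -> cvgC near_zero (fun h => f h / 2) 0.
  by move=> f0; have := cvgC_M f0 (cvgC_cst 2^-1); rewrite mul0r; exact.
have add (f g : ('I_4 -> 'I_4 -> C) -> C) : cvgC near_zero f 0 -> cvgC near_zero g 0 ->
    cvgC near_zero (fun h => f h + g h) 0.
  by move=> f0 g0; have := cvgC_D f0 g0; rewrite addr0; exact.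
have opp (f : ('I_4 -> 'I_4 -> C) -> C) :
    cvgC near_zero f 0 -> cvgC near_zero (fun h => - f h) 0.
  by move=> f0; have := cvgC_N f0; rewrite oppr0; exact.
have c := cvgC_coord.
elim/I4E: i; split; rewrite /x_log /y_log /=; apply: half; auto 6.
Qed.

Lemma cvgC_x_log i : cvgC near_zero (fun h => x_log h i) 0.
Proof. exact: (cvgC_logs i).1. Qed.

Lemma cvgC_y_log i : cvgC near_zero (fun h => y_log h i) 0.
Proof. exact: (cvgC_logs i).2. Qed.

Local Notation x h := (fun i => cexp (x_log h i)).
Local Notation y h := (fun i => cexp (y_log h i)).

Lemma cvgC_x i : cvgC near_zero (fun h => x h i) 1.
Proof. by rewrite -(@cexp0 R); apply: cvgC_cexp; apply: cvgC_x_log. Qed.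

Lemma cvgC_y i : cvgC near_zero (fun h => y h i) 1.
Proof. by rewrite -(@cexp0 R); apply: cvgC_cexp; apply: cvgC_y_log. Qed.

Lemma sym_one : [/\ sym1 (fun=> 1 : C) = 4, sym2 (fun=> 1 : C) = 6
  & sym3 (fun=> 1 : C) = 4].
Proof.
rewrite /sym1 /sym2 /sym3 !sumI4; do 4 rewrite big_mkcond sumI4 /=.
do 4 rewrite big_mkcond prodI4 /=.
by split; ring.
Qed.

Lemma Im_natM n (z : C) : complex.Im (n%:R * z) = n%:R * complex.Im z.
Proof. by rewrite -(rmorph_nat (real_complex R)) ImM /= mul0r addr0. Qed.

Lemma Re_natM n (z : C) : complex.Re (n%:R * z) = n%:R * complex.Re z.
Proof. by rewrite -(rmorph_nat (real_complex R)) ReM /= mul0r subr0. Qed.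

Lemma sqrtC_N256 : sqrtC (- 256) = 16 * I.
Proof.
have -> : - 256 = (16 * I) ^+ 2.
  by rewrite exprMn (_ : I ^+ 2 = -1); [ring | apply: complexP; rewrite /=; ring].
apply/sqrCK_P; rewrite -complexIm ler0c ltcE Im_natM /= mulr1 ler0n.
by rewrite eq_sym pnatr_eq0.
Qed.

Lemma cvgC_sym3 (u : ('I_4 -> 'I_4 -> C) -> 'I_4 -> C) :
  (forall i, cvgC near_zero (fun h => u h i) 1) ->
  cvgC near_zero (fun h => sym3 (u h)) 4.
Proof.
have [_ _ s3] := sym_one => cu; apply: (cvgC_eq s3).
by apply: cvgC_sum => i; apply: cvgC_prod.
Qed.

Lemma cvgC_quadratic_root e :
  cvgC near_zero (fun h => quadratic_root e (x h) (y h)) (e * I).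
Proof.
have [s1 s2 _] := sym_one.
have c1 (u : ('I_4 -> 'I_4 -> C) -> 'I_4 -> C) :
    (forall i, cvgC near_zero (fun h => u h i) 1) ->
    cvgC near_zero (fun h => sym1 (u h)) 4.
  by move=> cu; apply: (cvgC_eq s1); apply: cvgC_sum.
have c2 (u : ('I_4 -> 'I_4 -> C) -> 'I_4 -> C) :
    (forall i, cvgC near_zero (fun h => u h i) 1) ->
    cvgC near_zero (fun h => sym2 (u h)) 6.
  move=> cu; apply: (cvgC_eq s2); apply: cvgC_sum => i; apply: cvgC_sum => j.
  exact: cvgC_M.
have c3 := cvgC_sym3.
have cx := cvgC_x; have cy := cvgC_y.
(* All x_i and y_i tend to 1, so the symmetric functions tend to 4, 6, 4 and the discriminant to 0 -
   4 * 8 * 8. *)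
have cD : cvgC near_zero (fun h => discriminant (x h) (y h)) (- 256).
  apply: (@cvgC_eq _ _ _ ((6 - 6) * (6 - 6) - 4 * (4 + 4) * (4 + 4))); first by ring.
    apply: cvgC_B.
      by apply: cvgC_M; (apply: cvgC_B; [apply: c2 cx | apply: c2 cy]).
    apply: cvgC_M; last by apply: cvgC_D; [apply: c1 cx | apply: c1 cy].
    apply: cvgC_M; first exact: cvgC_cst.
    by apply: cvgC_D; [apply: c3 cx | apply: c3 cy].
have cS : cvgC near_zero (fun h => sqrtC (discriminant (x h) (y h))) (16 * I).
  rewrite -sqrtC_N256; apply: cvgC_sqrtC => //.
  by rewrite sqrtC_N256 Im_natM /= mulr1 ltr0n.
apply: (@cvgC_eq _ _ _ ((6 - 6 + e * (16 * I)) / (2 * (4 + 4)))); first by field.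
apply: cvgC_div.
- by rewrite -natrD -natrM pnatr_eq0.
- apply: cvgC_D; first by apply: cvgC_B; [apply: c2 cx | apply: c2 cy].
  by apply: cvgC_M; [exact: cvgC_cst | exact: cS].
- apply: cvgC_M; first exact: cvgC_cst.
  by apply: cvgC_D; [apply: c3 cx | apply: c3 cy].
Qed.

Lemma sqrI : I ^+ 2 = -1.
Proof. by apply: complexP; rewrite /=; ring. Qed.

Lemma Im_complex_neq0 a b : b != 0 -> (Complex a b : C) != 0.
Proof. by apply: contra; rewrite eq_complex => /andP[]. Qed.

Lemma I_neq1 : 1 - I != 0.
Proof.
rewrite (_ : 1 - I = Complex 1 (-1)) ?Im_complex_neq0 ?oppr_eq0 ?oner_eq0 //.
by apply: complexP; rewrite /=; ring.
Qed.

Lemma cvgC_denominators e : e ^+ 2 = 1 -> forall i,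
  [/\ cvgC near_zero (fun h => 1 - x h i * quadratic_root e (x h) (y h)) (1 - e * I),
      cvgC near_zero (fun h => 1 + y h i * quadratic_root e (x h) (y h)) (1 + e * I),
      1 - e * I != 0 & 1 + e * I != 0].
Proof.
move=> e2 i; have ct := cvgC_quadratic_root e.
(* As the product of the two limits is 2, neither vanishes. *)
have e1 : (1 - e * I) * (1 + e * I) = 2.
  by transitivity (1 - e ^+ 2 * I ^+ 2); [ring | rewrite e2 sqrI; ring].
have : (1 - e * I) * (1 + e * I) != 0 by rewrite e1 pnatr_eq0.
rewrite mulf_eq0 negb_or => /andP[n1 n2]; split=> //.
  rewrite -[X in _ - X]mul1r; apply: cvgC_B; first exact: cvgC_cst.
  exact: cvgC_M (cvgC_x i) ct.
rewrite -[X in _ + X]mul1r; apply: cvgC_D; first exact: cvgC_cst.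
exact: cvgC_M (cvgC_y i) ct.
Qed.

(** At x = y = 1 the formulas become - (1 - t) / (1 + t) and (1 + t) / (1 - t). Both fix the square
    roots of -1, so every shape has the same limit as t. *)
Lemma cvgC_solution_at e a : e ^+ 2 = 1 ->
  cvgC near_zero (fun h => solution_at (x h) (y h) (quadratic_root e (x h) (y h)) a)
    (e * I).
Proof.
move=> e2; case: a => s i; have [cx cy n1 n2] := cvgC_denominators e2 i.
have sq : (e * I) ^+ 2 = -1 by rewrite exprMn e2 sqrI mul1r.
case: s; rewrite /solution_at /=.
  have eq : 1 * - (1 - e * I) / (1 * (1 + e * I)) = e * I.
    rewrite !mul1r; apply: (mulIf n2); rewrite divfK // mulrDr mulr1 -expr2 sq; ring.
  apply: (cvgC_eq eq); apply: cvgC_div; first by rewrite mul1r.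
    apply: cvgC_M; first exact: cvgC_y.
    apply: (@cvgC_ext _ _ _ _ (fun h => - (1 - x h i * quadratic_root e (x h) (y h)))).
      by move=> h; rewrite opprB.
    exact: cvgC_N.
  by apply: cvgC_M => //; apply: cvgC_x.
have eq : (1 + e * I) / (1 - e * I) = e * I.
  by apply: (mulIf n1); rewrite divfK // mulrBr mulr1 -expr2 sq; ring.
by apply: (cvgC_eq eq); apply: cvgC_div.
Qed.

Lemma cvgC_block_solution a : cvgC near_zero (fun h => block_solution h a) I.
Proof.
have := @cvgC_solution_at 1 a; rewrite expr1n mul1r => /(_ erefl).
by apply: cvgC_ext => h; rewrite block_solutionE.
Qed.

Lemma shapes_I : shape' I = (1 + I) / 2 /\ shape'' I = 1 + I.
Proof.
have n0 : I != 0 by rewrite Im_complex_neq0 ?oner_eq0.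
have n1 := I_neq1.
have n2 : 2 != 0 :> C by rewrite pnatr_eq0.
split; last first.
  apply: (mulIf n0); rewrite mulrBl mulVf // mulrDl -expr2 sqrI; ring.
apply: (mulIf n1); rewrite mulVf //; apply: (mulIf n2).
rewrite mulrAC divfK //; transitivity (1 - I ^+ 2); last by ring.
by rewrite sqrI; ring.
Qed.

(** Each hypothesis of [block_equations_unique] and [block_solution_equations] follows from finitely
    many open conditions that hold in the limit, so all of them hold for small h. *)
Lemma near_zero_block_solution (r : R) : 0 < r -> \forall h \near near_zero,
  near_complete r (block_solution h) /\
  forall z : block_tetra -> C, positive_shapes z ->
    (block_equations h z <-> forall a, z a = block_solution h a).
Proof.
move=> r0.
have cb a := cvgC_block_solution a.
have n0 : I != 0 by rewrite Im_complex_neq0 ?oner_eq0.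
have [s1 s2] := shapes_I.
have n1 := I_neq1.
have c1 : \forall h \near near_zero, near_complete r (block_solution h).
  by apply: filter_forall => a; have /cvgCP := cb a; apply.
have c2 : \forall h \near near_zero, positive_shapes (block_solution h).
  by apply: filter_forall => a; apply: near_Im_gt0 (cb a); rewrite /= ltr01.
have c3 : \forall h \near near_zero,
    forall a, 0 < complex.Re (shape' (block_solution h a)).
  apply: filter_forall => a; apply: (@near_Re_gt0 _ _ _ _ _ (shape' I)).
    rewrite -(pmulr_rgt0 _ (ltr0Sn R 1)) -Re_natM s1 mulrC divfK ?pnatr_eq0 //.
    by rewrite /= addr0 ltr01.
  by apply: cvgC_V => //; apply: cvgC_B => //; apply: cvgC_cst.
have c4 : \forall h \near near_zero,
    forall a, 0 < complex.Re (shape'' (block_solution h a)).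
  apply: filter_forall => a; apply: (@near_Re_gt0 _ _ _ _ _ (shape'' I)).
    by rewrite s2 /= addr0 ltr01.
  by apply: cvgC_B; [apply: cvgC_cst | apply: cvgC_V].
have c5 : \forall h \near near_zero, sym3 (x h) + sym3 (y h) != 0.
  apply: (@near_neq _ _ _ _ _ (4 + 4)); first by rewrite -natrD pnatr_eq0.
  by apply: cvgC_D; apply: cvgC_sym3; [apply: cvgC_x | apply: cvgC_y].
have c6 : \forall h \near near_zero,
    complex.Im (solution_at (x h) (y h) (quadratic_root (-1) (x h) (y h)) (true, 0)) <= 0.
  have := @cvgC_solution_at (-1) (true, 0); rewrite sqrrN expr1n mulN1r.
  move=> /(_ erefl) /cvgC_N.
  rewrite opprK => /near_Im_gt0; rewrite ltr01 => /(_ isT).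
  by apply: filterS => h; rewrite ImN oppr_gt0 => /ltW.
have c7 : \forall h \near near_zero, 0 < complex.Im (quadratic_root 1 (x h) (y h)).
  have := cvgC_quadratic_root 1; rewrite mul1r => /near_Im_gt0; apply.
  by rewrite ltr01.
have c8 : \forall h \near near_zero,
    forall i, 1 - x h i * quadratic_root 1 (x h) (y h) != 0.
  apply: filter_forall => i.
  by have [c _ n _] := cvgC_denominators (expr1n C 2) i; apply: near_neq c.
have c9 : \forall h \near near_zero,
    forall i, 1 + y h i * quadratic_root 1 (x h) (y h) != 0.
  apply: filter_forall => i.
  by have [_ c _ n] := cvgC_denominators (expr1n C 2) i; apply: near_neq c.
have c10 : \forall h \near near_zero, forall i, x h i + y h i != 0.
  apply: filter_forall => i; apply: (@near_neq _ _ _ _ _ (1 + 1)).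
    by rewrite -mulr2n pnatr_eq0.
  by apply: cvgC_D; [apply: cvgC_x | apply: cvgC_y].
have small (u : ('I_4 -> 'I_4 -> C) -> 'I_4 -> C) :
    (forall i, cvgC near_zero (fun h => u h i) 0) ->
    \forall h \near near_zero, forall i, `|complex.Im (u h i)| < 1.
  move=> cu; apply: filter_forall => i; have /cvgCP /(_ _ ltr01) := cu i.
  by apply: filterS => h; rewrite subr0; apply: le_lt_trans; apply: le_Im_normc.
have c11 := small _ cvgC_x_log; have c12 := small _ cvgC_y_log.
near=> h.
have d1 : near_complete r (block_solution h) by near: h.
split=> // z z0; split=> [eqs|/funext->].
  by apply: block_equations_unique z0 eqs; near: h.
by apply: block_solution_equations; near: h.
Unshelve. all: by end_near.
Qed.

End NearComplete.

(** * Regular octahedra *)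

Section RegularOctahedron.
Variable R : realType.
Local Notation C := R[i].
Local Notation I := (Complex 0 1 : C).

Lemma regular_octahedron_vertices (m : bool) : regular_octahedron (regular_vertex R m).
Proof.
exists m, 1%:M; split=> [|i j _]; first exact: unitmx1.
exists 1; first exact: oner_neq0.
by rewrite !mxE /= !mul1r !mul0r addr0 add0r; case: (regular_vertex R m i j).
Qed.

(** The two octahedra of a block have opposite orientations, so the model is reflected according to
    [s]; each of the four cross ratios is then i. *)
Lemma regular_octahedron_placement (s : bool) :
  octahedron_placement s (fun=> I) (regular_vertex R s).
Proof.
split=> [i j|i /=].
  by rewrite /regular_vertex (eq_sym i) mate_flip (addnC j) (mulnC j).
have [n0 sq] : I != 0 /\ I * I = -1.
  by split; [rewrite Im_complex_neq0 ?oner_eq0 | rewrite -expr2 sqrI].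
rewrite /regular_vertex /cross_ratio /bracket.
have invI : I^-1 = - I.
  by apply: (mulfI n0); rewrite mulfV // mulrN sq opprK.
elim/I4E: i; rewrite ?I4_add2 !mateE /= ?I4_add2 ?mateE /=; case: s => /=;
  rewrite !(expr0, expr1, mulr1, mul1r, mulr0, mul0r, subr0, sub0r, mulN1r,
    mulrN1, mulNr, mulrN, opprK, invrN, invr1, invI) //.
Qed.

Lemma carg_I : carg I = pi / 2.
Proof. by rewrite /carg /= ler01 mul0r acos0. Qed.

Lemma carg_natM n (z : C) : carg (n.+1%:R * z) = carg z.
Proof.
rewrite /carg Re_natM Im_natM normcM pmulr_rge0 ?ltr0n //.
have -> : normc (n.+1%:R : C) = n.+1%:R.
  by rewrite -(rmorph_nat (real_complex R)) /= expr0n addr0 sqrtr_sqr ger0_norm.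
by rewrite -mulf_div divff ?mul1r // pnatr_eq0.
Qed.

(** At i one has z'' = 2 z', so z' and z'' have equal arguments, and these share the pi / 2 that the
    argument of i leaves in the total pi. *)
Lemma carg_shapes_I : carg (shape' I) = pi / 4 /\ carg (shape'' I) = pi / 4.
Proof.
have [s1 s2] := shapes_I R.
have e : carg (shape'' I) = carg (shape' I).
  by rewrite -(carg_natM 1 (shape' I)) s1 s2 mulrC divfK // pnatr_eq0.
have := congr1 (@complex.Im R) (clog_shapes (ltr01 : 0 < complex.Im I)).
by rewrite !ImD /= e carg_I; split; lra.
Qed.

End RegularOctahedron.

(** * A fixed neighbourhood of the complete structure, and zero holonomies *)

Section NearCompletePositive.
Variable R : realType.

(** The disc of radius 1 around i lies in the upper half-plane, which justifies the choice r = 1 in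
    the theorem. *)
Lemma near_complete_gt0 (T : Type) (z : T -> R[i]) :
  near_complete 1 z -> positive_shapes z.
Proof.
move=> z1 t; have := le_lt_trans (le_Im_normc _) (z1 t).
by rewrite ImD ImN /= ltr_norml => /andP[+ _]; lra.
Qed.

Lemma block_solution_near_complete : exists2 d : R, 0 < d &
  forall h : 'I_4 -> 'I_4 -> R[i],
    (forall i j : 'I_4, (i < j)%N -> normc (h i j) < d) ->
    near_complete 1 (block_solution h) /\
    (forall z : block_tetra -> R[i], positive_shapes z ->
       (block_equations h z <-> forall a, z a = block_solution h a)).
Proof. by have [d d0 hd] := near_zero_block_solution (@ltr01 R); exists d. Qed.

(** The zero holonomy lies in every neighbourhood of itself, so its solution is within every
    positive distance of i. *)
Lemma block_solution0 a : block_solution (fun _ _ => 0) a = Complex 0 1 :> R[i].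
Proof.
apply/eqP/negPn/negP => ne.
have r0 : 0 < normc (block_solution (fun _ _ => 0 : R[i]) a - Complex 0 1).
  by rewrite normc_gt0 // subr_eq0.
have [d d0 hd] := near_zero_block_solution r0.
have [|/(_ a)] := hd (fun _ _ => 0); first by move=> i j _; rewrite normc0.
by rewrite ltxx.
Qed.

Lemma block_equations0 (z : block_tetra -> R[i]) : positive_shapes z ->
  (block_equations (fun _ _ => 0) z <-> forall a, z a = Complex 0 1).
Proof.
move=> z0; have [d d0 hd] := block_solution_near_complete.
have [|_ /(_ _ z0) ->] := hd (fun _ _ => 0); first by move=> i j _; rewrite normc0.
by split=> e a; rewrite e block_solution0.
Qed.

End NearCompletePositive.

Theorem theorem1p1 (R : realType) (c : nat) (G : fsl_gluing c)
    (M : {set link_arc c}) (c_gt0 : (0 < c)%N) (hM : meridian_system G M) :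
  (* (1) *)
  (exists z : 'I_c * block_tetra -> R[i],
     [/\ complete_structure G M z,
         (forall z', complete_structure G M z' -> z' =1 z),
         (forall b s, exists p : 'I_4 -> 'I_4 -> ideal_point R,
            regular_octahedron p /\
            octahedron_placement s (fun i => z (b, (s, i))) p)
       & (forall t, [/\ carg (z t) = pi / 2, carg (shape' (z t)) = pi / 4
                      & carg (shape'' (z t)) = pi / 4])]) /\
  (* (2) *)
  (exists r d : R, [/\ 0 < r, 0 < d &
     forall h : 'I_4 -> 'I_4 -> R[i],
       (forall i j : 'I_4, (i < j)%N -> normc (h i j) < d) ->
       near_complete r (block_solution h) /\
       (forall z : block_tetra -> R[i], near_complete r z ->
          (block_equations h z <-> forall a, z a = block_solution h a))]) /\
  (* (3) *)
  (forall (H : link_arc c -> R[i]) (z : 'I_c * block_tetra -> R[i]),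
     link_holonomy G H -> positive_shapes z ->
     (gluing_equation G M H z <->
      forall b, block_equations (fun i j => H (b, i, j))
                                (fun a => z (b, a)))) /\
  (exists r d : R, [/\ 0 < r, 0 < d &
     forall H : link_arc c -> R[i],
       link_holonomy G H -> (forall a, proper_arc a -> normc (H a) < d) ->
       (forall b, near_complete r (block_solution (fun i j => H (b, i, j)))) /\
       (forall z : 'I_c * block_tetra -> R[i], near_complete r z ->
          (gluing_equation G M H z <->
           forall b a, z (b, a) = block_solution (fun i j => H (b, i, j)) a))]).
Proof.
have [d d0 hd] := block_solution_near_complete R.
split; [|split; [|split]].
- have h0 : link_holonomy G (fun=> 0 : R[i]) by split=> // a; rewrite oppr0.
  (* For zero holonomies the problem splits into blocks, on each of which i is the only positive
     solution. *)
  have compl (z : 'I_c * block_tetra -> R[i]) : positive_shapes z ->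
      gluing_equation G M (fun=> 0) z <->
      forall b a, z (b, a) = Complex 0 1.
    move=> z0; rewrite (gluing_equationP hM h0 z0).
    by split=> e b; apply/block_equations0; try exact: e; move=> a; apply: z0.
  exists (fun=> Complex 0 1); split.
  + have z0 : positive_shapes (fun _ : 'I_c * block_tetra => Complex 0 1 : R[i]).
      by move=> t; exact: ltr01.
    by split=> //; apply/compl.
  + by move=> z' [z0 /(compl _ z0) e] [b a].
  + move=> b s; exists (regular_vertex R s); split.
      exact: regular_octahedron_vertices.
    exact: regular_octahedron_placement.
  + by move=> _; have [] := carg_shapes_I R; split=> //; apply: carg_I.
- exists 1, d; split=> // h /hd[near eqs]; split=> // z /near_complete_gt0.
  exact: eqs.
- by move=> H z hH z0; apply: gluing_equationP.
(* The bound d from one block serves all blocks at once, since it does not depend on the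
   holonomies. *)
- exists 1, d; split=> // H hH Hd.
  have small b : forall i j : 'I_4, (i < j)%N -> normc (H (b, i, j)) < d.
    by move=> i j ij; apply: Hd; rewrite /proper_arc /= neq_ltn ij.
  split=> [b|z zn]; first by have [] := hd _ (small b).
  have z0 := near_complete_gt0 zn; rewrite (gluing_equationP hM hH z0).
  split=> e b; have [_ /(_ (fun a => z (b, a))) eqs] := hd _ (small b).
    by apply/eqs; [move=> a; apply: z0 | apply: e].
  by apply/eqs; [move=> a; apply: z0 | apply: e].
Qed.
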